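(* Let $d\ge 1$ and let $S\subset\mathbb{Z}^d$ satisfy $S\cup(-S)=\mathbb{Z}^d\setminus\{\mathbf 0\}$, $S\cap(-S)=\emptyset$ and $S+S\subset S$. Let $S_n\subset -S$ be finite ordered sets increasing to $-S$. Let $\mu=\psi\overline{\varphi}\,\lambda$ for some pair of spectral factors $\varphi,\psi$ that satisfy $$\liminf_{n\to\infty}\epsilon\bigl(\varphi\cdot[-S_n],\,\psi\cdot[-S_n];\,L^2(\lambda)\bigr)>0 .$$ Given any two finite ordered sets of functions $\mathcal F,\mathcal G\subset L^2(|\varphi|^2+|\psi|^2)$ of the same cardinality, let $\mathcal F' := \langle P_{\mathrm{HL}^2}(f\overline{\varphi}) : f\in\mathcal F\rangle$ and $\mathcal G' := \langle P_{\mathrm{HL}^2}(g\overline{\psi}) : g\in\mathcal G\rangle$ (with the induced orders). Then $$\lim_{n\to\infty}\frac{\bigl(\mathcal F\Cup(S_n),\,\mathcal G\Cup(S_n)\bigr)_\mu}{\bigl((S_n),(S_n)\bigr)_\mu} = \bigl(\mathcal F',\mathcal G'\bigr)_\lambda .$$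
   Context: $\lambda$ is Lebesgue measure on $\mathbb{T}^d=\mathbb{R}^d/\mathbb{Z}^d$. For $k\in\mathbb{Z}^d$, $e_k(x) := e^{2\pi i k\cdot x}$, and $\widehat f(k) := \int_{\mathbb{T}^d} f\,\overline{e_k}\,d\lambda$. For a weight $w\ge0$, $L^2(w)$ means $L^2(w\lambda)$. $\mathrm{HL}^2 := \{\varphi\in L^2(\mathbb{T}^d) : \operatorname{supp}\widehat\varphi\subset S\cup\{\mathbf 0\}\}$, and $P_{\mathrm{HL}^2}:L^2(\mathbb{T}^d)\to\mathrm{HL}^2$ is the orthogonal projection $\sum_{k\in\mathbb{Z}^d}a_ke_k\mapsto\sum_{k\in S\cup\{\mathbf 0\}}a_ke_k$. For $R\subseteq\mathbb{Z}^d$, $[R]$ is the linear span of $\{e_k : k\in R\}$, and for $0\le f\in L^1(\lambda)$, $[R]_f$ is its closure in $L^2(f)$. A spectral factor is a function $\varphi\in\mathrm{HL}^2$ with $\widehat\varphi(\mathbf 0)>0$ and $1/\varphi\in[S\cup\{\mathbf 0\}]_{|\varphi|^2}$. $\varphi\cdot[R] := \{\varphi h : h\in[R]\}$. For non-zero subspaces $H_1,K_1$ of a Hilbert space $H$, $\epsilon(H_1,K_1;H) := \inf_{x\in H_1,\|x\|=1}\ \sup_{y\in K_1,\|y\|=1}|(x,y)|$. For $A\subseteq\mathbb{Z}^d$, $(A)$ denotes the set of corresponding exponentials $\{e_k : k\in A\}$ (ordered as $A$ is, when $A$ is ordered). For finite ordered sets (finite lists) of functions $\mathcal F,\mathcal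 G$ of the same cardinality, $\bigl(\mathcal F,\mathcal G\bigr)_\mu := \det\bigl[\int p\,\overline q\,d\mu\bigr]_{p\in\mathcal F,q\in\mathcal G}$, also for complex measures $\mu$, the orderings being used to order the rows and columns. $\mathcal F\Cup\mathcal G$ denotes the concatenation of $\mathcal G$ after $\mathcal F$. ''$S_n$ increasing to $-S$'' means $S_n\subseteq S_{n+1}$ for all $n$ and $\bigcup_n S_n=-S$. The limit is taken over large $n$, for which (under the hypotheses) the denominator is nonzero. *)

(* Defs.v *)
From HB Require Import structures.
From mathcomp Require Import all_boot all_order all_algebra.
From mathcomp Require Import all_classical all_reals all_analysis.
From mathcomp Require Export complex.

Set Implicit Arguments.
Unset Strict Implicit.
Unset Printing Implicit Defensive.
Import Order.TTheory GRing.Theory Num.Theory.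
Import numFieldNormedType.Exports.

Local Open Scope classical_set_scope.
Local Open Scope ring_scope.
Local Open Scope complex_scope.

Local Notation Re := (@complex.Re _).
Local Notation Im := (@complex.Im _).

(* The torus T^d = R^d / Z^d is represented by its fundamental domain [0, 1[^d:
   functions on the torus are functions on R^d (realized as d.-tuple R, with the
   product sigma-algebra), considered modulo the measure [lebesgueT], i.e. the
   d-dimensional Lebesgue measure restricted to [0, 1[^d.  Elements of L^2 are
   represented by measurable functions; no definition below depends on the choice
   of a representative. *)
Notation torus R d := (d.-tuple (measurableTypeR R)).

Section lebesgue_torus.
Context {R : realType}.
Local Notation mR := (measurableTypeR R).

Definition lebesgue01 : set mR -> \bar R :=
  mrestr lebesgue_measure (measurable_itv `[0%R, 1%R[).

HB.instance Definition _ := Measure.on lebesgue01.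

Lemma lebesgue01_setT : lebesgue01 setT = 1%E.
Proof.
by rewrite /lebesgue01/= /mrestr setTI lebesgue_measure_itv/= lte01 oppr0 adde0.
Qed.

HB.instance Definition _ :=
  Measure_isProbability.Build _ _ _ lebesgue01 lebesgue01_setT.

Definition cons_point n (p : mR * torus R n) : torus R n.+1 :=
  [tuple of p.1 :: p.2].

Lemma measurable_cons_point n : measurable_fun setT (@cons_point n).
Proof. exact: measurable_cons. Qed.

HB.instance Definition _ n :=
  isMeasurableFun.Build _ _ _ _ (@cons_point n) (@measurable_cons_point n).

Fixpoint lebesgueT (d : nat) : probability (torus R d) R :=
  match d with
  | 0 => dirac ([tuple] : torus R 0)
  | n.+1 => distribution (lebesgue01 \x lebesgueT n)%E (@cons_point n)
  end.

(* [lebesgueT] is characterized by its values on boxes. *)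
Lemma lebesgueT_box d (A : 'I_d -> set mR) : (forall i, measurable (A i)) ->
  lebesgueT d [set x | forall i, A i (tnth x i)] =
  (\prod_(i < d) lebesgue_measure (A i `&` `[0%R, 1%R[))%E.
Proof.
elim: d A => [|d IH] A mA.
  by rewrite big_ord0 /= diracE mem_set// => -[].
rewrite big_ord_recl /= /distribution /pushforward.
rewrite (_ : _ @^-1` _ = A ord0 `*`
    [set x : torus R d | forall i, A (lift ord0 i) (tnth x i)]); last first.
  apply/seteqP; split => [[x t] /= h|[x t] /= [h0 h] i].
    split=> /=; first by have := h ord0.
    by move=> i; have := h (lift ord0 i); rewrite /cons_point/= tnthS.
  by case: (unliftP ord0 i) => [j|] ->; rewrite /cons_point /= ?tnthS ?tnth0.
rewrite product_measure1E//.
  by congr (_ * _)%E; exact: (IH (fun i => A (lift ord0 i))).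
rewrite (_ : [set x | _] = \bigcap_(i in [set: 'I_d])
    ((fun x : torus R d => tnth x i) @^-1` A (lift ord0 i))); last first.
  by apply/seteqP; split => x /= h i; [move=> _|]; exact: h.
apply: fin_bigcap_measurable => [|i _]; first exact: finite_finset.
by rewrite -[X in measurable X]setTI; exact: measurable_tnth.
Qed.

End lebesgue_torus.

Section torus_functions.
Context {R : realType} {d : nat}.
Local Notation C := (R[i]).
Local Notation Zd := 'rV[int]_d.
Local Notation func := (torus R d -> C).
Local Notation lam := (lebesgueT d : measure _ R).

Definition expk (k : Zd) : func := fun x =>
  let theta := 2 * pi * (\sum_(i < d) (k ord0 i)%:~R * tnth x i) in
  cos theta +i* sin theta.

Definition Cmeasurable (f : func) :=
  measurable_fun setT (Re \o f) /\ measurable_fun setT (Im \o f).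

Definition Cintegral (f : func) : C :=
  (\int[lam]_x Re (f x))%R +i* (\int[lam]_x Im (f x))%R.

Definition cabs (z : C) : R := Re `|z|.

Definition weightedL2 (w : torus R d -> R) : set func := [set f |
  Cmeasurable f /\ (\int[lam]_x (cabs (f x) ^+ 2 * w x)%:E < +oo)%E].

Definition L2 : set func := weightedL2 (cst 1).

Definition innerL2 (f g : func) : C := Cintegral (fun x => f x * (g x)^*).

Definition normL2 (f : func) : R := Num.sqrt (\int[lam]_x (cabs (f x) ^+ 2))%R.

Definition fourier (f : func) (k : Zd) : C := innerL2 f (expk k).

Definition HL2 (S : set Zd) : set func := [set f | L2 f /\
  forall k, fourier f k != 0 -> (S `|` [set 0]) k].

(* The coefficientwise projection; the graph is a singleton up to equality
   almost everywhere when [L2 f], and [xget] picks a representative. *)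
Definition projHL2 (S : set Zd) (f : func) : func :=
  xget (cst 0) [set g | L2 g /\ forall k : Zd,
    ((S `|` [set 0]) k -> fourier g k = fourier f k) /\
    (~ (S `|` [set 0]) k -> fourier g k = 0)].

Definition trig_span (A : set Zd) : set func := [set f |
  exists (s : seq Zd) (c : Zd -> C), [set` s] `<=` A /\
    f = fun x => \sum_(k <- s) c k * expk k x].

Definition closed_span (A : set Zd) (w : torus R d -> R) : set func := [set f |
  weightedL2 w f /\ forall eps : R, 0 < eps -> exists2 p, trig_span A p &
    (\int[lam]_x (cabs (f x - p x) ^+ 2 * w x)%:E < eps%:E)%E].

Definition spectral_factor (S : set Zd) (phi : func) :=
  [/\ HL2 S phi, 0 < fourier phi 0 &
      closed_span (S `|` [set 0]) (fun x => cabs (phi x) ^+ 2)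
                  (fun x => (phi x)^-1)].

Definition mul_span (phi : func) (A : set Zd) : set func :=
  [set (fun x => phi x * h x) | h in trig_span A].

(* epsilon(H, K; L^2(lambda)), computed in the extended reals *)
Definition epsilonL2 (H K : set func) : \bar R :=
  ereal_inf [set ereal_sup [set (cabs (innerL2 x y))%:E
                           | y in [set y | K y /\ normL2 y = 1]]
            | x in [set x | H x /\ normL2 x = 1]].

(* (F, G)_mu for the complex measure mu = rho lambda *)
Definition gramdet (rho : func) n (F G : n.-tuple func) : C :=
  \det (\matrix_(i < n, j < n)
    Cintegral (fun x => tnth F i x * (tnth G j x)^* * rho x)).

Definition exps (s : seq Zd) : (size s).-tuple func :=
  map_tuple expk (in_tuple s).

End torus_functions.

Definition oppset {d : nat} (A : set 'rV[int]_d) : set 'rV[int]_d :=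
  [set - k | k in A].

(* Main.v *)
(* Write u = f phi^* and v = g psi^*: every entry of the Gram matrices is an inner
   product <u, v> in L^2(lambda), with a_k = e_k phi^* and b_l = e_l psi^* for the
   functions that come from the exponentials.  By a Schur complement the ratio is
   the determinant of the <u_i - T_n u_i, v_j>, where T_n u is the element of
   span(a_k, k in S_n) such that u - T_n u is orthogonal to all b_l, l in S_n.  The
   lower bound on epsilon bounds T_n uniformly.  As T_n h = h as soon as h is in the
   span, and as T_n vanishes on HL^2 (b_l has its spectrum in -S), it follows that
   u - T_n u converges to P u, provided the a_k, k in -S, span a dense subspace of
   the functions with spectrum in -S; this holds because phi is outer.  Finally
   <P u, v> = <P u, P v>. *)
From HB Require Import structures.
Require Import Defs.
From mathcomp Require Import all_boot all_order all_algebra.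
From mathcomp Require Import all_classical all_reals all_analysis.
From mathcomp Require Import measurable_realfun ring lra.
Import Order.TTheory GRing.Theory Num.Theory.
Import numFieldNormedType.Exports.
Set Implicit Arguments.
Unset Strict Implicit.
Unset Printing Implicit Defensive.
Local Open Scope classical_set_scope.
Local Open Scope ring_scope.

Local Notation "x %:C" := (real_complex _ x) : ring_scope.
Local Notation Re := (@complex.Re _).
Local Notation Im := (@complex.Im _).

(** * Semi-inner products *)

(** T_n is an oblique projection, so its norm has no bound of its own; the hypothesis on epsilon
    acts through a Galerkin argument. Let h be a fixed combination of the a_k close to u - P u. For
    large n, T_n u - h is in the span of the a_k, and against b_l it has the same inner product as u
    - P u - h, because u - T_n u and P u are both orthogonal to b_l. So its norm is at most 1/eps
    times that of u - P u - h. The same bound makes the Gram matrix invertible: a combination of the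
    a_k orthogonal to all b_l has norm zero, and the a_k are independent by their top frequencies.
    The spaces in the hypothesis are the conjugates of the spans of the a_k and b_k; conjugation
    keeps the moduli of inner products. Functions are not identified almost everywhere. The Hilbert
    space arguments use a semi-inner product, and most limits are taken by showing that a set is a
    closed submodule and contains the generators. The exponentials are total for measure-theoretic
    reasons: indicators of half-spaces are, on the fundamental domain, bounded limits of
    trigonometric polynomials, so a function with zero coefficients has integral zero over every
    measurable set. *)

Section complex_modulus.
Context {R : realType}.
Implicit Types z : R[i].

Lemma cabsE z : cabs z = Num.sqrt (Re z ^+ 2 + Im z ^+ 2).
Proof. by rewrite /cabs normc_def. Qed.

Lemma cabs_sqr z : cabs z ^+ 2 = Re z ^+ 2 + Im z ^+ 2.
Proof. by rewrite cabsE sqr_sqrtr// addr_ge0// sqr_ge0. Qed.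

Lemma normc_cabs z : `|z| = (cabs z)%:C.
Proof. by rewrite cabsE normc_def. Qed.

Lemma cabs_ge0 z : 0 <= cabs z.
Proof. by rewrite cabsE sqrtr_ge0. Qed.

Lemma cabsM z1 z2 : cabs (z1 * z2) = cabs z1 * cabs z2.
Proof. by apply: complexI; rewrite -normc_cabs normrM !normc_cabs -rmorphM. Qed.

Lemma cabs_conj z : cabs z^* = cabs z.
Proof. by apply: complexI; rewrite -!normc_cabs norm_conjC. Qed.

Lemma conj_real (r : R) : (r%:C)^* = r%:C.
Proof. exact: conjc_real. Qed.

Lemma complex_ReM (z1 z2 : R[i]) : Re (z1 * z2) = Re z1 * Re z2 - Im z1 * Im z2.
Proof. by case: z1 z2 => [a b] [c d]. Qed.

Lemma complex_ImM (z1 z2 : R[i]) : Im (z1 * z2) = Re z1 * Im z2 + Im z1 * Re z2.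
Proof. by case: z1 z2 => [a b] [c d]. Qed.

Lemma complex_ReD (z1 z2 : R[i]) : Re (z1 + z2) = Re z1 + Re z2.
Proof. by case: z1 z2 => [a b] [c d]. Qed.

Lemma complex_ImD (z1 z2 : R[i]) : Im (z1 + z2) = Im z1 + Im z2.
Proof. by case: z1 z2 => [a b] [c d]. Qed.

Lemma complex_Re_conj z : Re z^* = Re z. Proof. by case: z. Qed.
Lemma complex_Im_conj z : Im z^* = - Im z. Proof. by case: z. Qed.

Lemma mul_conj z : z * z^* = (cabs z ^+ 2)%:C.
Proof. by rewrite -normCK normc_cabs rmorphXn. Qed.

Lemma cabs_real (r : R) : cabs r%:C = `|r|.
Proof. by rewrite cabsE /= expr0n addr0 sqrtr_sqr. Qed.

Lemma norm_Re_le z : `|Re z| <= cabs z.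
Proof. by rewrite cabsE -sqrtr_sqr ler_wsqrtr// lerDl sqr_ge0. Qed.

Lemma norm_Im_le z : `|Im z| <= cabs z.
Proof. by rewrite cabsE -sqrtr_sqr ler_wsqrtr// lerDr sqr_ge0. Qed.

End complex_modulus.

Section semi_inner_product.
Context {R : realType} {V : lmodType R[i]}.
Variable ip : V -> V -> R[i].

Record semi_inner := SemiInner {
  ip_linearl : forall a u v w, ip (a *: u + v) w = a * ip u w + ip v w;
  ip_herm : forall u v, ip v u = (ip u v)^*;
  ip_ge0 : forall u, 0 <= ip u u }.

Definition ipnorm u := Num.sqrt (Re (ip u u)).

Lemma ipnormE u : ipnorm u = Num.sqrt (Re (ip u u)).
Proof. by []. Qed.

Hypothesis ipP : semi_inner.

Let h := ip_linearl ipP.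
Let ipC := ip_herm ipP.

Lemma ipDl u v w : ip (u + v) w = ip u w + ip v w.
Proof. by have := h 1 u v w; rewrite scale1r mul1r. Qed.

Lemma ip0l w : ip 0 w = 0.
Proof. by apply: (addrI (ip 0 w)); rewrite -ipDl !addr0. Qed.

Lemma ipZl a u w : ip (a *: u) w = a * ip u w.
Proof. by have := h a u 0 w; rewrite ip0l !addr0. Qed.

Lemma ipNl u w : ip (- u) w = - ip u w.
Proof. by rewrite -scaleN1r ipZl mulN1r. Qed.

Lemma ipBl u v w : ip (u - v) w = ip u w - ip v w.
Proof. by rewrite ipDl ipNl. Qed.

Lemma ipDr u v w : ip u (v + w) = ip u v + ip u w.
Proof. by rewrite ipC ipDl rmorphD /= -!ipC. Qed.

Lemma ip0r w : ip w 0 = 0.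
Proof. by rewrite ipC ip0l conjC0. Qed.

Lemma ipZr a u w : ip u (a *: w) = a^* * ip u w.
Proof. by rewrite ipC ipZl rmorphM /= -ipC. Qed.

Lemma ipBr u v w : ip u (v - w) = ip u v - ip u w.
Proof. by rewrite ipC ipBl rmorphB /= -!ipC. Qed.

Lemma ip_suml I (r : seq I) P (F : I -> V) w :
  ip (\sum_(i <- r | P i) F i) w = \sum_(i <- r | P i) ip (F i) w.
Proof.
by elim/big_rec2: _ => [|i x y _ <-]; rewrite ?ip0l// ipDl.
Qed.

Lemma ip_sumr I (r : seq I) P (F : I -> V) w :
  ip w (\sum_(i <- r | P i) F i) = \sum_(i <- r | P i) ip w (F i).
Proof.
by elim/big_rec2: _ => [|i x y _ <-]; rewrite ?ip0r// ipDr.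
Qed.

Lemma ipnorm_ge0 u : 0 <= ipnorm u. Proof. exact: sqrtr_ge0. Qed.

Lemma Re_ip_ge0 u : 0 <= Re (ip u u).
Proof. by have := ip_ge0 ipP u; rewrite lecE => /andP[]. Qed.

Lemma ipnorm_sqr u : ipnorm u ^+ 2 = Re (ip u u).
Proof. by rewrite sqr_sqrtr// Re_ip_ge0. Qed.

Lemma ipE u : ip u u = (ipnorm u ^+ 2)%:C.
Proof.
rewrite ipnorm_sqr; have := ip_ge0 ipP u; rewrite lecE => /andP[/eqP + _].
by case: (ip u u) => a b /= ->.
Qed.

Lemma ipnorm_eq0 u : ipnorm u = 0 <-> ip u u = 0.
Proof.
rewrite ipE; split=> [->|]; first by rewrite expr0n.
by move=> /complexI/eqP; rewrite sqrf_eq0 => /eqP.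
Qed.

Lemma ipnormZ a u : ipnorm (a *: u) = cabs a * ipnorm u.
Proof.
apply: (@pexpIrn _ 2) => //.
- by rewrite nnegrE ipnorm_ge0.
- by rewrite nnegrE mulr_ge0 ?cabs_ge0 ?ipnorm_ge0.
rewrite exprMn; apply: complexI; rewrite -ipE ipZl ipZr mulrA mul_conj ipE.
by rewrite -rmorphM.
Qed.

Lemma ipnormN u : ipnorm (- u) = ipnorm u.
Proof.
rewrite -scaleN1r ipnormZ -(rmorphN1 (real_complex R)) cabs_real.
by rewrite normrN1 mul1r.
Qed.

Lemma ipnormB_sym u v : ipnorm (u - v) = ipnorm (v - u).
Proof. by rewrite -ipnormN opprB. Qed.

(** The squared norm of [u - (s * ip u v) *: v] is a nonnegative quadratic in the real [s], the
    factor [ip u v] absorbing the phase. The form may be degenerate, hence a separate case for [v]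
    of norm zero. *)
Lemma ip_cauchy_schwarz u v : cabs (ip u v) <= ipnorm u * ipnorm v.
Proof.
rewrite -(@ler_pXn2r _ 2)// ?nnegrE ?cabs_ge0 ?mulr_ge0 ?ipnorm_ge0//.
rewrite exprMn.
set b := cabs (ip u v) ^+ 2.
have H (s : R) : 0 <= ipnorm u ^+ 2 - s * b *+ 2 + s ^+ 2 * b * ipnorm v ^+ 2.
  have := ip_ge0 ipP (u - (s%:C * ip u v) *: v).
  have ct : (s%:C * ip u v)^* = s%:C * (ip u v)^*.
    by rewrite rmorphM; congr (_ * _); exact: conj_real.
  rewrite ipBl !ipBr !ipZl !ipZr (ipC u v) !ipE ct.
  have -> : (ipnorm u ^+ 2)%:C - s%:C * (ip u v)^* * ip u v -
      (s%:C * ip u v * (ip u v)^* - s%:C * ip u v *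
       (s%:C * (ip u v)^* * (ipnorm v ^+ 2)%:C)) =
     (ipnorm u ^+ 2)%:C - s%:C * (ip u v * (ip u v)^*) *+ 2 +
      s%:C ^+ 2 * (ip u v * (ip u v)^*) * (ipnorm v ^+ 2)%:C by ring.
  by rewrite mul_conj -/b -!(rmorphM, rmorphXn, rmorphMn, rmorphB, rmorphD) ler0c.
have b0 : 0 <= b by rewrite sqr_ge0.
have [v0|v0] := eqVneq (ipnorm v ^+ 2) 0.
  rewrite v0 mulr0 leNgt; apply/negP => bgt0.
  (* The quadratic is now affine in [s]; this value would make it [- ipnorm u ^+ 2 - 2]. *)
  have := H ((ipnorm u ^+ 2 + 1) / b); rewrite v0 mulr0 addr0 mulrVK ?unitfE ?gt_eqF//.
  have := sqr_ge0 (ipnorm u); lra.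
have vgt0 : 0 < ipnorm v ^+ 2 by rewrite lt_neqAle eq_sym v0 sqr_ge0.
(* The minimizer of the quadratic. *)
have := H (ipnorm v ^+ 2)^-1.
have -> : ipnorm u ^+ 2 - (ipnorm v ^+ 2)^-1 * b *+ 2 +
   (ipnorm v ^+ 2)^-1 ^+ 2 * b * ipnorm v ^+ 2 = ipnorm u ^+ 2 - b / (ipnorm v ^+ 2).
  by field; rewrite -sqrf_eq0.
by rewrite subr_ge0 ler_pdivrMr.
Qed.

Lemma ipnormD_sqr u v :
  ipnorm (u + v) ^+ 2 = ipnorm u ^+ 2 + ipnorm v ^+ 2 + Re (ip u v) *+ 2.
Proof.
rewrite !ipnorm_sqr ipDl !ipDr (ipC u v) !complex_ReD complex_Re_conj; ring.
Qed.

Lemma ipnormD u v : ipnorm (u + v) <= ipnorm u + ipnorm v.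
Proof.
rewrite -(@ler_pXn2r _ 2)// ?nnegrE ?addr_ge0 ?ipnorm_ge0// ipnormD_sqr sqrrD.
rewrite addrAC lerD2r lerD2l ler_pMn2r//.
apply: le_trans (ler_norm _) _.
exact: (le_trans (norm_Re_le _) (ip_cauchy_schwarz _ _)).
Qed.

Lemma ipnorm0 : ipnorm 0 = 0. Proof. by rewrite ipnorm_eq0 ip0l. Qed.

Lemma ipnormB_tri u v w : ipnorm (u - w) <= ipnorm (u - v) + ipnorm (v - w).
Proof. by rewrite -[u - w](subrKA v) ipnormD. Qed.

Lemma ipnorm_pythagoras u v : ip u v = 0 ->
  ipnorm (u + v) ^+ 2 = ipnorm u ^+ 2 + ipnorm v ^+ 2.
Proof. by rewrite ipnormD_sqr => -> /=; rewrite mul0rn addr0. Qed.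

Lemma ipnorm_null u v : ipnorm u = 0 -> ip u v = 0.
Proof.
move=> u0; have := ip_cauchy_schwarz u v; rewrite u0 mul0r => le.
have /eqP : cabs (ip u v) = 0 by apply/eqP; rewrite eq_le le cabs_ge0.
by rewrite -(inj_eq (@complexI R)) -normc_cabs normr_eq0 => /eqP.
Qed.

End semi_inner_product.

(** * Orthonormal expansions and closed submodules *)

Section orthonormal_expansion.
Context {R : realType} {V : lmodType R[i]} (ip : V -> V -> R[i]).
Hypothesis ipP : semi_inner ip.
Local Notation ipnorm := (ipnorm ip).

(* Closed for the seminorm: [M] is also stable under changes of norm zero, so that
   functions equal almost everywhere need not be identified. *)
Definition closed_submod (M : set V) :=
  [/\ M 0, forall a u v, M u -> M v -> M (a *: u + v) &
      forall v, (forall eps, 0 < eps -> exists2 w, M w & ipnorm (v - w) < eps) ->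
        M v].

(** Geometrically fast sequences are enough: a Cauchy sequence has such a subsequence, and
    [expansion] extracts one. *)
Hypothesis complete_ip : forall v : nat -> V,
  (forall n, ipnorm (v n.+1 - v n) <= 2 ^- n) ->
  exists w, ipnorm (v n - w) @[n --> \oo] --> 0.

Lemma ortho_closed_submod u : closed_submod [set v | ip v u = 0].
Proof.
split => [|a v w|v H] /=.
- by rewrite (ip0l ipP).
- by move=> /= v0 w0; rewrite (ip_linearl ipP) v0 w0 mulr0 addr0.
apply/eqP; rewrite -normr_eq0 normc_cabs (inj_eq (@complexI R)).
rewrite eq_le cabs_ge0 andbT; apply/ler_addgt0Pl => e e0; rewrite addr0.
have d0 : 0 < e / (ipnorm u + 1) by rewrite divr_gt0// ltr_wpDl// ipnorm_ge0.
have [w /= wu vw] := H _ d0.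
rewrite -[v](subrK w) (ipDl ipP) wu addr0.
rewrite (le_trans (ip_cauchy_schwarz ipP _ _))//.
rewrite (le_trans (ler_wpM2r _ (ltW vw))) ?ipnorm_ge0//.
rewrite mulrAC ler_pdivrMr ?ltr_wpDl ?ipnorm_ge0//.
by rewrite ler_wpM2l ?(ltW e0)// lerDl.
Qed.

Section sequence.
Variable eo : nat -> V.
Hypothesis eo_orth : forall i j, i != j -> ip (eo i) (eo j) = 0.
Hypothesis eo_norm : forall i, eo i = 0 \/ ip (eo i) (eo i) = 1.
Variable u : V.

Definition partial_exp n := \sum_(i < n) ip u (eo i) *: eo i.

Lemma ip_partial_exp n j : (j < n)%N -> ip (partial_exp n) (eo j) = ip u (eo j).
Proof.
move=> jn; rewrite (ip_suml ipP) (bigD1 (Ordinal jn))//= big1 ?addr0.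
  rewrite (ipZl ipP).
  by case: (eo_norm j) => ->; rewrite ?(ip0r ipP) ?mulr0 ?mulr1.
move=> i /eqP ij; rewrite (ipZl ipP) eo_orth ?mulr0//.
by apply/eqP => e; apply: ij; apply/val_inj.
Qed.

Lemma ip_partial_exp_lt v n : (forall j, (j < n)%N -> ip v (eo j) = 0) ->
  ip v (partial_exp n) = 0.
Proof.
by move=> H; rewrite (ip_sumr ipP) big1// => i _; rewrite (ipZr ipP) H ?mulr0.
Qed.

Lemma ipnorm_partial_expB m n : (n <= m)%N ->
  ipnorm (partial_exp m - partial_exp n) ^+ 2 =
  ipnorm (partial_exp m) ^+ 2 - ipnorm (partial_exp n) ^+ 2.
Proof.
move=> nm; rewrite -[X in _ = ipnorm X ^+ 2 - _](subrK (partial_exp n)).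
rewrite [X in _ = X - _](ipnorm_pythagoras ipP) ?addrK//.
apply: ip_partial_exp_lt => j jn; rewrite (ipBl ipP) !ip_partial_exp ?subrr//.
exact: leq_trans nm.
Qed.

Lemma partial_exp_nd :
  nondecreasing_seq (fun n => ipnorm (partial_exp n) ^+ 2).
Proof.
by move=> n m nm; rewrite -subr_ge0 -ipnorm_partial_expB// sqr_ge0.
Qed.

Lemma bessel n : ipnorm (partial_exp n) ^+ 2 <= ipnorm u ^+ 2.
Proof.
rewrite -[X in _ <= ipnorm X ^+ 2](subrK (partial_exp n)).
rewrite (ipnorm_pythagoras ipP) ?lerDr ?sqr_ge0//.
apply: ip_partial_exp_lt => j jn; rewrite (ipBl ipP) ip_partial_exp ?subrr//.
Qed.

(** By Bessel the squared norms of the partial sums increase to a finite limit, and by Pythagoras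
    their differences control the partial sums, which are therefore Cauchy. The approximation clause
    has the form that [closed_submod] consumes. *)
Lemma expansion : exists2 w, (forall j, ip w (eo j) = ip u (eo j)) &
  forall eps, 0 < eps -> exists n, ipnorm (w - partial_exp n) < eps.
Proof.
have cva : cvgn (fun n => ipnorm (partial_exp n) ^+ 2).
  apply: nondecreasing_is_cvgn; first exact: partial_exp_nd.
  by exists (ipnorm u ^+ 2) => _ [n _ <-]; exact: bessel.
(* The condition [k <= n] lets the chosen indices pass every [j], although they need not be
   monotone. *)
have cauchy k : exists n, (k <= n)%N /\ forall m, (n <= m)%N ->
    ipnorm (partial_exp m - partial_exp n) <= 2 ^- k.
  have e0 : 0 < (2 ^- k : R) ^+ 2 by rewrite exprn_gt0// invr_gt0 exprn_gt0.
  move/cvgrPdist_lt: (cva) => /(_ _ e0)[N _ HN].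
  exists (maxn k N); split => [|m]; first exact: leq_maxl.
  rewrite geq_max => /andP[km Nm].
  rewrite -(@ler_pXn2r _ 2)// ?nnegrE ?ipnorm_ge0 ?invr_ge0 ?exprn_ge0//.
  rewrite ipnorm_partial_expB ?geq_max ?km//.
  apply/ltW; have := HN _ (leq_maxr k N) => /=.
  apply: le_lt_trans; rewrite (le_trans _ (ler_norm _))// lerD2r.
  exact: nondecreasing_cvgn_le partial_exp_nd cva _.
have {cauchy} [f /all_and2[fk Hf]] := choice cauchy.
have [|w Hw] := complete_ip (v := fun k => partial_exp (f k)).
  (* When [f k.+1 < f k], the stronger estimate attached to [k.+1] is used instead. *)
  move=> k; have [|/ltnW] := leqP (f k) (f k.+1); first exact: Hf.
  move=> fk1; rewrite (ipnormB_sym ipP) /=; apply: (le_trans (Hf _ _ fk1)).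
  by rewrite lef_pV2 ?posrE ?exprn_gt0// ler_weXn2l// ler1n.
have cl eps : 0 < eps -> exists N, forall n, (N <= n)%N ->
    ipnorm (w - partial_exp (f n)) < eps.
  move=> /(cvgr0_norm_lt _ Hw)[N _ HN]; exists N => n Nn.
  rewrite (ipnormB_sym ipP); have := HN n Nn => /=; rewrite ger0_norm ?ipnorm_ge0//.
exists w; last by move=> eps /cl[N /(_ N (leqnn _))]; exists (f N).
move=> j; apply/eqP; rewrite -subr_eq0 -(ipBl ipP); apply/eqP.
(* Orthogonality to [eo j] passes to limits, and [partial_exp n - u] has it as soon as [j < n]. *)
have [_ _ H] := ortho_closed_submod (eo j).
apply: (H (w - u)) => eps /cl[N HN].
exists (partial_exp (f (maxn N j.+1)) - u) => /=.
  rewrite (ipBl ipP) ip_partial_exp ?subrr//.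
  by apply: leq_trans (fk _); rewrite leq_maxr.
rewrite opprB addrA subrK.
by apply: HN; rewrite leq_maxl.
Qed.

End sequence.

Variables (I : countType) (e : I -> V).
Hypothesis e_orth : forall i j, ip (e i) (e j) = (i == j)%:R.

(** [w] is the sum of the expansion of [u] over [A]. The last clause says that it is a limit of
    combinations of the [e k] with [k] in [A], without mentioning sums. *)
Lemma riesz_fischer (A : set I) u : exists w,
  [/\ forall k, A k -> ip w (e k) = ip u (e k),
      forall k, ~ A k -> ip w (e k) = 0 &
      forall M, closed_submod M -> (forall k, A k -> M (e k)) -> M w].
Proof.
(* Numbers that code no index, or an index outside [A], are sent to the zero vector. *)
pose eo n := if pickle_inv n is Some k then (if `[< A k >] then e k else 0)
             else (0 : V).
have eo_orth i j : i != j -> ip (eo i) (eo j) = 0.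
  rewrite /eo; case Ei: (pickle_inv i) => [k|]; last by rewrite (ip0l ipP).
  case: ifP => Ak; last by rewrite (ip0l ipP).
  case Ej: (pickle_inv j) => [l|]; last by rewrite (ip0r ipP).
  case: ifP => Al; last by rewrite (ip0r ipP).
  rewrite e_orth => /eqP ij; case: (eqVneq k l) => // kl; case: ij.
  have := @pickle_invK I i; have := @pickle_invK I j.
  by rewrite Ei Ej /= => <- <-; rewrite kl.
have eo_norm i : eo i = 0 \/ ip (eo i) (eo i) = 1.
  rewrite /eo; case: pickle_inv => [k|]; last by left.
  case: ifP => _; last by left.
  by right; rewrite e_orth eqxx.
have [w Hw wlim] := expansion eo_orth eo_norm u.
exists w; split=> [k Ak|k nAk|M [M0 MZD Mcl] Me].
- by have := Hw (pickle k); rewrite /eo pickleK_inv asboolT.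
- have [_ _ H] := ortho_closed_submod (e k).
  apply: H => eps /wlim[n Hn]; exists (partial_exp eo u n) => //=.
  rewrite (ip_suml ipP) big1// => i _; rewrite (ipZl ipP) /eo.
  case: pickle_inv => [l|]; last by rewrite (ip0l ipP) mulr0.
  case: ifP => [/asboolP Al|_]; last by rewrite (ip0l ipP) mulr0.
  by rewrite e_orth; case: eqP => [lk|_]; rewrite ?mulr0//; case: nAk; rewrite -lk.
- apply: Mcl => eps /wlim[n Hn]; exists (partial_exp eo u n) => //.
  rewrite /partial_exp; elim/big_ind: _ => [//|x y Mx My|i _].
    by rewrite -[x]scale1r; exact: MZD.
  rewrite -[X in M X]addr0; apply: MZD => //; rewrite /eo.
  by case: pickle_inv => [k|//]; case: ifP => [/asboolP/Me|].
Qed.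

Hypothesis e_total : forall u, (forall k, ip u (e k) = 0) -> ipnorm u = 0.

(** [v] differs from its own expansion over [A] by a vector with no nonzero coefficient; totality
    gives it norm zero, and [M] absorbs it. *)
Lemma closed_submod_supp (A : set I) M v : closed_submod M ->
  (forall k, A k -> M (e k)) -> (forall k, ~ A k -> ip v (e k) = 0) -> M v.
Proof.
move=> Mc Me v0; have [w [wA wnA /(_ _ Mc Me) Mw]] := riesz_fischer A v.
have [_ _ H] := Mc; apply: H => eps eps0; exists w => //.
rewrite e_total// => k; rewrite (ipBl ipP).
by have [Ak|nAk] := pselect (A k); [rewrite wA|rewrite v0// wnA]; rewrite ?subrr.
Qed.

(** The orthogonal of [u] is a closed submodule that contains every [e k] with [k] in [A]. *)
Lemma ip_disjoint_supp (A : set I) u v : (forall k, A k -> ip u (e k) = 0) ->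
  (forall k, ~ A k -> ip v (e k) = 0) -> ip u v = 0.
Proof.
move=> u0 v0; rewrite (ip_herm ipP).
suff /= -> : [set x | ip x u = 0] v by rewrite conjC0.
apply: (closed_submod_supp (A := A)) => // [|k Ak /=].
  exact: ortho_closed_submod.
by rewrite (ip_herm ipP) u0// conjC0.
Qed.

End orthonormal_expansion.

(** * Oblique projections and Gram determinants *)

Section determinants.

(** Block elimination: a unipotent upper triangular factor times a lower triangular one with the
    Schur complement and [D] on the diagonal. *)
Lemma det_schur (F : fieldType) m n (A : 'M[F]_m) B C (D : 'M[F]_n) :
  \det D != 0 ->
  \det (block_mx A B C D) / \det D = \det (A - B *m invmx D *m C).
Proof.
move=> D0; have uD : D \in unitmx by rewrite unitmxE unitfE.
have -> : block_mx A B C D = block_mx 1%:M (B *m invmx D) 0 1%:M *m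
    block_mx (A - B *m invmx D *m C) 0 C D.
  rewrite mulmx_block !mul1mx !mul0mx !add0r.
  by rewrite mulmxKV// subrK.
by rewrite det_mulmx det_ublock det_lblock !det1 !mul1r mulfK.
Qed.

Lemma cvg_det (K : numFieldType) n (A : nat -> 'M[K]_n) (B : 'M[K]_n) :
  (forall i j, (fun k => A k i j) @ \oo --> B i j) ->
  (fun k => \det (A k)) @ \oo --> \det B.
Proof.
move=> AB; apply: cvg_big => [|s _]; first exact: add_continuous.
apply: cvgM; first exact: cvg_cst.
by apply: cvg_big => [|i _]; [exact: mul_continuous|exact: AB].
Qed.

End determinants.

Section oblique_projection.
Context {R : realType} {V : lmodType R[i]} (ip : V -> V -> R[i]).
Hypothesis ipP : semi_inner ip.
Local Notation ipnorm := (ipnorm ip).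
Context {I : choiceType} (a b : I -> V) (Sn : nat -> seq I).
Hypothesis Sn_uniq : forall n, uniq (Sn n).
Hypothesis Sn_incr : forall n, [set` Sn n] `<=` [set` Sn n.+1].

Definition comb (x : I -> V) n (c : I -> R[i]) := \sum_(k <- Sn n) c k *: x k.

Hypothesis a_free : forall n c, ipnorm (comb a n c) = 0 ->
  forall k, k \in Sn n -> c k = 0.
Variables (eps : R) (N0 : nat).
Hypothesis eps_gt0 : 0 < eps.
(** The angle condition freed of unit vectors: [B] is any bound for the functional that a
    combination of the [a k] induces on the span of the [b k]. *)
Hypothesis lower_bound : forall n, (N0 <= n)%N -> forall c B, 0 <= B ->
  (forall c', cabs (ip (comb a n c) (comb b n c')) <= B * ipnorm (comb b n c')) ->
  eps * ipnorm (comb a n c) <= B.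

Local Notation s n := (tnth (in_tuple (Sn n))).

Lemma Sn_subset n n' : (n <= n')%N -> {subset Sn n <= Sn n'}.
Proof.
move=> /subnK <-; elim: (n' - n)%N => [//|m IH] k kn.
by rewrite addSn; exact: (Sn_incr (IH _ kn)).
Qed.

Lemma comb_widen x n n' c : (n <= n')%N -> exists c', comb x n c = comb x n' c'.
Proof.
move=> nn'; exists (fun k => if k \in Sn n then c k else 0).
rewrite /comb [RHS](bigID (mem (Sn n)))/= [X in _ = _ + X]big1 ?addr0; last first.
  by move=> k /negbTE ->; rewrite scale0r.
under [in RHS]eq_bigr => k kn do rewrite kn /=.
rewrite -[RHS]big_filter; apply: perm_big; apply: uniq_perm => //.
  by rewrite filter_uniq.
move=> k; rewrite mem_filter; case: (boolP (k \in Sn n)) => //=.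
by move=> /(Sn_subset nn').
Qed.

Lemma comb_ordinal x n (r : 'rV_(size (Sn n))) : exists c,
  (forall i, c (s n i) = r 0 i) /\ comb x n c = \sum_i r 0 i *: x (s n i).
Proof.
pose c k := \sum_(i | s n i == k) r 0 i.
have inj : injective (s n) by apply/tuple_uniqP; exact: Sn_uniq.
have cE i : c (s n i) = r 0 i.
  by rewrite /c (big_pred1 i)// => j; rewrite /= (inj_eq inj).
by exists c; split => //; rewrite /comb big_tnth; under eq_bigr do rewrite cE.
Qed.

Lemma mem_SnP n k : k \in Sn n -> exists j, k = s n j.
Proof. by move=> /(tnthP (in_tuple (Sn n)) k). Qed.

Definition cross_gram n : 'M[R[i]]_(size (Sn n)) :=
  \matrix_(i, j) ip (a (s n i)) (b (s n j)).

Lemma ip_sum_cross n (r : 'rV_(size (Sn n))) j :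
  ip (\sum_i r 0 i *: a (s n i)) (b (s n j)) = (r *m cross_gram n) 0 j.
Proof.
by rewrite (ip_suml ipP) mxE; apply: eq_bigr => i _; rewrite (ipZl ipP) mxE.
Qed.

Lemma ip_comb0 v n : (forall k, k \in Sn n -> ip v (b k) = 0) ->
  forall c, ip v (comb b n c) = 0.
Proof.
move=> H c; rewrite (ip_sumr ipP) big_seq big1// => k kn.
by rewrite (ipZr ipP) H ?mulr0.
Qed.

(** A row in the kernel gives a combination of the [a k] orthogonal to all [b k]; [lower_bound] with
    [B = 0] gives it norm zero, and freeness kills its coefficients. The matrix being square, a
    trivial left kernel is enough. *)
Lemma cross_gram_det n : (N0 <= n)%N -> \det (cross_gram n) != 0.
Proof.
move=> n0; apply/negP => /det0P[r r0 rD0]; case/eqP: r0.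
have [c [cE cs]] := comb_ordinal a r.
have c0 : ipnorm (comb a n c) = 0.
  apply/eqP; rewrite eq_le ipnorm_ge0 andbT -(pmulr_rle0 _ eps_gt0).
  apply: (lower_bound n0) => // c'; rewrite mul0r ip_comb0 => [|k /mem_SnP[j ->]].
    by rewrite -(rmorph0 (real_complex R)) cabs_real normr0.
  by rewrite cs ip_sum_cross rD0 mxE.
apply/rowP => i; rewrite mxE -cE; apply: (a_free c0).
exact: mem_tnth.
Qed.

(* The projection on the span of the [a k] parallel to the orthogonal of the
   [b k], [k \in Sn n]. *)
Definition oblique n u : V :=
  \sum_i ((\row_j ip u (b (s n j))) *m invmx (cross_gram n)) 0 i *: a (s n i).

Lemma oblique_ortho n u k : (N0 <= n)%N -> k \in Sn n ->
  ip (u - oblique n u) (b k) = 0.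
Proof.
move=> n0 /mem_SnP[j ->]; rewrite (ipBl ipP) ip_sum_cross.
by rewrite mulmxKV ?unitmxE ?unitfE ?cross_gram_det// mxE subrr.
Qed.

Variables u p : V.
Hypothesis p_ortho : forall n k, k \in Sn n -> ip p (b k) = 0.
Hypothesis u_approx : forall del, 0 < del ->
  exists n c, ipnorm (u - p - comb a n c) < del.

(** Quasi-optimality, as in Cea's lemma: the error is at most [1 + eps^-1] times the distance of
    [u - p] to a combination available at an earlier stage. *)
Lemma oblique_cvg : forall del, 0 < del ->
  \forall n \near \oo, ipnorm (u - oblique n u - p) < del.
Proof.
(* Chosen so that [d + d / eps = del / 2]. *)
move=> del del0; pose d := del / (2 * (1 + eps^-1)).
have e1 : 0 < 1 + eps^-1 by rewrite ltr_wpDl// invr_gt0.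
have d0 : 0 < d by rewrite divr_gt0// mulr_gt0.
have [n1 [c1 Hc1]] := u_approx d0.
exists (maxn N0 n1) => // n /=; rewrite geq_max => /andP[n0 n1n].
have [c2 c12] := comb_widen a c1 n1n.
have [c [_ cE]] := comb_ordinal a
  ((\row_j ip u (b (s n j))) *m invmx (cross_gram n)).
rewrite -[\sum_i _]/(oblique n u) in cE.
have xE : oblique n u - comb a n1 c1 = comb a n (fun k => c k - c2 k).
  rewrite c12 -cE /comb -sumrB; apply: eq_bigr => k _.
  by rewrite scalerBl.
have xd : eps * ipnorm (oblique n u - comb a n1 c1) <= d.
  rewrite xE; apply: lower_bound (ltW d0) _ => // c'; rewrite -xE.
  (* The second difference is orthogonal to the [b k] of stage [n], so only the first one, of norm
     less than [d], is seen. *)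
  have -> : oblique n u - comb a n1 c1 =
      (u - p - comb a n1 c1) - (u - oblique n u - p).
    by rewrite [u - oblique n u - p]addrAC opprB [RHS]addrC addrA subrK.
  rewrite (ipBl ipP) [X in _ - X]ip_comb0 ?subr0 => [|k kn].
    apply: le_trans (ip_cauchy_schwarz ipP _ _) _.
    by rewrite ler_wpM2r ?ipnorm_ge0// ltW.
  by rewrite (ipBl ipP) (p_ortho kn) subr0 oblique_ortho.
rewrite addrAC; apply: le_lt_trans (ipnormB_tri ipP _ (comb a n1 c1) _) _.
have {}xd : ipnorm (comb a n1 c1 - oblique n u) <= d / eps.
  by rewrite (ipnormB_sym ipP) ler_pdivlMr// mulrC.
apply: le_lt_trans (lerD (ltW Hc1) xd) _.
have -> : d + d / eps = del / 2.
  by rewrite /d; field; rewrite !gt_eqF// addr_gt0.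
by rewrite ltr_pdivrMr// mulr_natr mulr2n ltrDl.
Qed.

End oblique_projection.

(** * Convergence of the ratio in an abstract semi-inner product space *)

Section gram_ratio.
Context {R : realType} {V : lmodType R[i]} (ip : V -> V -> R[i]).
Hypothesis ipP : semi_inner ip.
Local Notation ipnorm := (ipnorm ip).

Lemma cvg_ip (x : nat -> V) (p w : V) :
  (forall del, 0 < del -> \forall n \near \oo, ipnorm (x n - p) < del) ->
  (fun n => ip (x n) w : R[i]^o) @ \oo --> (ip p w : R[i]^o).
Proof.
move=> xp; apply/cvgrPdist_lt => -[e1 e2]; rewrite ltcE /= => /andP[/eqP -> e10].
have d0 : 0 < e1 / (ipnorm w + 1) by rewrite divr_gt0// ltr_wpDl// ipnorm_ge0.
apply: filterS (xp _ d0) => n xn.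
rewrite distrC -(ipBl ipP) normc_cabs ltcR.
apply: le_lt_trans (ip_cauchy_schwarz ipP _ _) _.
apply: le_lt_trans (ler_wpM2l (ipnorm_ge0 _ _) (_ : _ <= ipnorm w + 1)) _.
  by rewrite lerDl.
by rewrite -ltr_pdivlMr// ltr_wpDl// ipnorm_ge0.
Qed.

Context {I : choiceType} (a b : I -> V) (Sn : nat -> seq I).
Hypothesis Sn_uniq : forall n, uniq (Sn n).
Hypothesis Sn_incr : forall n, [set` Sn n] `<=` [set` Sn n.+1].
Hypothesis a_free : forall n c, ipnorm (comb Sn a n c) = 0 ->
  forall k, k \in Sn n -> c k = 0.
Variables (eps : R) (N0 : nat).
Hypothesis eps_gt0 : 0 < eps.
Hypothesis lower_bound : forall n, (N0 <= n)%N -> forall c B, 0 <= B ->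
  (forall c', cabs (ip (comb Sn a n c) (comb Sn b n c')) <=
              B * ipnorm (comb Sn b n c')) ->
  eps * ipnorm (comb Sn a n c) <= B.
Local Notation s n := (tnth (in_tuple (Sn n))).

(** The Schur complement has entries [ip (u i - oblique n (u i)) (w j)], which converge one by one.
    [p i] plays the projection of [u i], known only through its orthogonality to the [b k] and the
    approximation of [u i - p i]. *)
Lemma cvg_gram_ratio m (u p w : 'I_m -> V) :
  (forall i n k, k \in Sn n -> ip (p i) (b k) = 0) ->
  (forall i del, 0 < del ->
    exists n c, ipnorm (u i - p i - comb Sn a n c) < del) ->
  (fun n => \det (block_mx
     (\matrix_(i, j) ip (u i) (w j)) (\matrix_(i, j) ip (u i) (b (s n j)))
     (\matrix_(i, j) ip (a (s n i)) (w j)) (cross_gram ip a b Sn n)) /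
     \det (cross_gram ip a b Sn n) : R[i]^o) @ \oo -->
  (\det (\matrix_(i, j) ip (p i) (w j)) : R[i]^o).
Proof.
move=> p_ortho u_approx.
pose A n : 'M[R[i]]_m :=
  \matrix_(i, j) ip (u i - oblique ip a b Sn n (u i)) (w j).
have AB : (fun n => \det (A n) : R[i]^o) @ \oo -->
    (\det (\matrix_(i, j) ip (p i) (w j)) : R[i]^o).
  apply: cvg_det => i j; rewrite mxE.
  under eq_cvg do rewrite mxE.
  apply: cvg_ip => del.
  apply: (oblique_cvg ipP Sn_uniq Sn_incr a_free eps_gt0 lower_bound) => //.
    exact: p_ortho.
  exact: u_approx.
apply: cvg_trans AB; apply: near_eq_cvg.
exists N0 => // n /= n0; rewrite det_schur; last first.
  exact: (cross_gram_det ipP Sn_uniq a_free eps_gt0 lower_bound n0).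
congr (\det _); apply/matrixP => i j; rewrite !mxE (ipBl ipP); congr (_ - _).
rewrite (ip_suml ipP); apply: eq_bigr => k _; rewrite (ipZl ipP) mxE; congr (_ * _).
by rewrite !mxE; apply: eq_bigr => l _; rewrite !mxE.
by rewrite mxE.
Qed.

End gram_ratio.

(** * The space L^2 of the torus *)

Section complex_integration.
Context {R : realType} {d : nat}.
Local Notation T := (d.-tuple (measurableTypeR R)).
Local Notation func := (T -> R[i]).
Local Notation lam := (lebesgueT d : measure _ R).
Implicit Types f g h : func.

Definition Cintegrable f :=
  lam.-integrable setT (fun x => (Re (f x))%:E) /\
  lam.-integrable setT (fun x => (Im (f x))%:E).

Lemma CmeasurableD f g : Cmeasurable f -> Cmeasurable g ->
  Cmeasurable (fun x => f x + g x).
Proof.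
move=> [f1 f2] [g1 g2]; split.
- by under [X in measurable_fun _ X]eq_fun => x do
    rewrite /= complex_ReD; exact: measurable_funD.
- by under [X in measurable_fun _ X]eq_fun => x do
    rewrite /= complex_ImD; exact: measurable_funD.
Qed.

Lemma CmeasurableM f g : Cmeasurable f -> Cmeasurable g ->
  Cmeasurable (fun x => f x * g x).
Proof.
move=> [f1 f2] [g1 g2]; split.
- under [X in measurable_fun _ X]eq_fun => x do rewrite /= complex_ReM.
  by apply: measurable_funB; exact: measurable_funM.
- under [X in measurable_fun _ X]eq_fun => x do rewrite /= complex_ImM.
  by apply: measurable_funD; exact: measurable_funM.
Qed.

Lemma Cmeasurable_conj f : Cmeasurable f -> Cmeasurable (fun x => (f x)^*).
Proof.
move=> [f1 f2]; split.
- by under [X in measurable_fun _ X]eq_fun => x do rewrite /= complex_Re_conj.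
- under [X in measurable_fun _ X]eq_fun => x do rewrite /= complex_Im_conj.
  exact: measurableT_comp.
Qed.

Lemma Cmeasurable_cst c : Cmeasurable (fun _ : T => c).
Proof. by split; exact: measurable_cst. Qed.

Lemma measurable_cabs_sqr f : Cmeasurable f ->
  measurable_fun setT (fun x => cabs (f x) ^+ 2).
Proof.
move=> [f1 f2]; under eq_fun do rewrite cabs_sqr.
by apply: measurable_funD; exact: measurable_funX.
Qed.

Lemma integrable_dom (h k : T -> R) : measurable_fun setT h ->
  lam.-integrable setT (EFin \o k) -> (forall x, `|h x| <= k x) ->
  lam.-integrable setT (EFin \o h).
Proof.
move=> mh ik hk; apply: le_integrable ik => //.
  exact/measurable_EFinP.
by move=> x _ /=; rewrite lee_fin (le_trans (hk x))// ler_norm.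
Qed.

Lemma Cintegrable_dom h (k : T -> R) : Cmeasurable h ->
  lam.-integrable setT (EFin \o k) -> (forall x, cabs (h x) <= k x) ->
  Cintegrable h.
Proof.
move=> [h1 h2] ik hk; split.
- by apply: (integrable_dom h1 ik) => x; exact: le_trans (norm_Re_le _) _.
- by apply: (integrable_dom h2 ik) => x; exact: le_trans (norm_Im_le _) _.
Qed.

Lemma L2_integrable f : L2 f ->
  lam.-integrable setT (EFin \o (fun x => cabs (f x) ^+ 2)).
Proof.
move=> [mf fy]; apply/integrableP; split.
  by apply/measurable_EFinP; exact: measurable_cabs_sqr.
under eq_integral do rewrite /= ger0_norm ?sqr_ge0//.
by under eq_integral do rewrite -[X in X%:E]mulr1.
Qed.

Lemma L2_dom h (k : T -> R) : Cmeasurable h ->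
  lam.-integrable setT (EFin \o k) -> (forall x, cabs (h x) ^+ 2 <= k x) -> L2 h.
Proof.
move=> mh ik hk.
have /integrableP[_] : lam.-integrable setT (EFin \o (fun x => cabs (h x) ^+ 2)).
  apply: integrable_dom ik _; first exact: measurable_cabs_sqr.
  by move=> x; rewrite ger0_norm ?sqr_ge0.
under eq_integral do rewrite /= ger0_norm ?sqr_ge0//.
by split => //; under eq_integral do rewrite mulr1.
Qed.

Lemma cabsD_sqr_le (z w : R[i]) :
  cabs (z + w) ^+ 2 <= 2 * cabs z ^+ 2 + 2 * cabs w ^+ 2.
Proof.
rewrite !cabs_sqr complex_ReD complex_ImD.
have := sqr_ge0 (Re z - Re w); have := sqr_ge0 (Im z - Im w); nra.
Qed.

Lemma integrable_funD (h k : T -> R) : lam.-integrable setT (EFin \o h) ->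
  lam.-integrable setT (EFin \o k) ->
  lam.-integrable setT (EFin \o (fun x => h x + k x)).
Proof. by move=> ih ik; have := integrableD measurableT ih ik. Qed.

Lemma integrable_funZl r (h : T -> R) : lam.-integrable setT (EFin \o h) ->
  lam.-integrable setT (EFin \o (fun x => r * h x)).
Proof. by move=> ih; have := integrableZl measurableT r ih. Qed.

Lemma L2D f g : L2 f -> L2 g -> L2 (fun x => f x + g x).
Proof.
move=> f2 g2.
apply: (L2_dom (k := fun x => 2 * cabs (f x) ^+ 2 + 2 * cabs (g x) ^+ 2)).
- by apply: CmeasurableD; [case: f2|case: g2].
- by apply: integrable_funD; apply: integrable_funZl; exact: L2_integrable.
- by move=> x; exact: cabsD_sqr_le.
Qed.

Lemma L2M_bounded (b : func) M f : Cmeasurable b -> (forall x, cabs (b x) <= M) ->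
  L2 f -> L2 (fun x => b x * f x).
Proof.
move=> mb bM f2; apply: (L2_dom (k := fun x => M ^+ 2 * cabs (f x) ^+ 2)).
- by apply: CmeasurableM; [|case: f2].
- by apply: integrable_funZl; exact: L2_integrable.
- move=> x; rewrite cabsM exprMn ler_wpM2r ?sqr_ge0//.
  by rewrite ler_pXn2r ?nnegrE ?cabs_ge0// (le_trans _ (bM x))// cabs_ge0.
Qed.

Lemma L2Z a f : L2 f -> L2 (fun x => a * f x).
Proof.
by apply: (L2M_bounded (M := cabs a)) => //; exact: Cmeasurable_cst.
Qed.

Lemma L2_conj f : L2 f -> L2 (fun x => (f x)^*).
Proof.
move=> f2; apply: (L2_dom _ (L2_integrable f2)) => [|x].
  by apply: Cmeasurable_conj; case: f2.
by rewrite cabs_conj.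
Qed.

Lemma L2_cst c : L2 (fun _ : T => c).
Proof.
apply: (L2_dom (k := fun _ : T => cabs c ^+ 2)) => //; first exact: Cmeasurable_cst.
exact: finite_measure_integrable_cst.
Qed.

Lemma L2_cintegrable f g : L2 f -> L2 g -> Cintegrable (fun x => f x * (g x)^*).
Proof.
move=> f2 g2.
apply: (Cintegrable_dom (k := fun x => cabs (f x) ^+ 2 + cabs (g x) ^+ 2)).
- by apply: CmeasurableM; [case: f2|apply: Cmeasurable_conj; case: g2].
- by apply: integrable_funD; exact: L2_integrable.
- move=> x; rewrite cabsM cabs_conj.
  have := sqr_ge0 (cabs (f x) - cabs (g x)); have := cabs_ge0 (f x).
  have := cabs_ge0 (g x); nra.
Qed.

Lemma CintegralD f g : Cintegrable f -> Cintegrable g ->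
  Cintegral (fun x => f x + g x) = Cintegral f + Cintegral g.
Proof.
move=> [f1 f2] [g1 g2]; rewrite /Cintegral.
under eq_Rintegral do rewrite complex_ReD.
rewrite RintegralD//; under [X in Complex _ X]eq_Rintegral do rewrite complex_ImD.
by rewrite RintegralD.
Qed.

Lemma CintegralZ a f : Cintegrable f ->
  Cintegral (fun x => a * f x) = a * Cintegral f.
Proof.
move=> [f1 f2]; rewrite /Cintegral.
under eq_Rintegral do rewrite complex_ReM.
under [X in Complex _ X]eq_Rintegral do rewrite complex_ImM.
rewrite RintegralB ?RintegralD//; [|exact: integrable_funZl..].
by rewrite !RintegralZl//; case: a.
Qed.

Lemma Cintegral_conj f : Cintegrable f ->
  Cintegral (fun x => (f x)^*) = (Cintegral f)^*.
Proof.
move=> [f1 f2]; rewrite /Cintegral.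
under eq_Rintegral do rewrite complex_Re_conj.
under [X in Complex _ X]eq_Rintegral do rewrite complex_Im_conj -mulN1r.
by rewrite RintegralZl// mulN1r.
Qed.

End complex_integration.

Section L2_space.
Context {R : realType} {d : nat}.
Local Notation T := (d.-tuple (measurableTypeR R)).
Local Notation func := (T -> R[i]^o).
Local Notation lam := (lebesgueT d : measure _ R).

Definition L2_pred : {pred func} := fun f => `[< L2 f >].

Lemma L2_predP (f : func) : reflect (L2 f) (f \in L2_pred).
Proof. exact: asboolP. Qed.

Lemma L2_submod_closed : submod_closed L2_pred.
Proof.
split=> [|a f g /L2_predP f2 /L2_predP g2]; apply/L2_predP.
  exact: L2_cst.
by apply: L2D => //; exact: L2Z.
Qed.

HB.instance Definition _ := GRing.isSubmodClosed.Build R[i] func L2_pred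
  L2_submod_closed.

(** Functions rather than classes: [L2ip] is degenerate, its null vectors being the functions that
    vanish almost everywhere. *)
Record L2T := MkL2T { L2val :> func; L2valP : L2val \in L2_pred }.

HB.instance Definition _ := [isSub for L2val].
HB.instance Definition _ := [Choice of L2T by <:].
HB.instance Definition _ := [SubChoice_isSubLmodule of L2T by <:].

Definition toL2 (f : func) (f2 : L2 f) : L2T := MkL2T (introT (L2_predP f) f2).

Lemma L2T_L2 (f : L2T) : L2 f.
Proof. exact/L2_predP/L2valP. Qed.

Definition L2ip (f g : L2T) := innerL2 f g.

Lemma Cintegral_ge0 (f : func) : (forall x, 0 <= f x) -> 0 <= Cintegral f.
Proof.
move=> f0; rewrite lecE /Cintegral /=; apply/andP; split.
  have -> : (fun x => Im (f x)) = cst 0.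
    by apply/funext => x; have := f0 x; rewrite lecE => /andP[/eqP].
  by rewrite Rintegral_cst// mul0r.
by apply: Rintegral_ge0 => // x _; have := f0 x; rewrite lecE => /andP[].
Qed.

Lemma L2ip_semi_inner : semi_inner L2ip.
Proof.
split => [a f g h|f g|f].
- rewrite /L2ip /innerL2 -CintegralZ; last exact: L2_cintegrable (L2T_L2 _) (L2T_L2 _).
  rewrite -CintegralD; last 1 first.
  + exact: L2_cintegrable (L2T_L2 _) (L2T_L2 _).
  + congr Cintegral; apply/funext => x.
    by rewrite [in RHS]mulrA -mulrDl.
  + have := L2_cintegrable (L2Z a (L2T_L2 f)) (L2T_L2 h).
    by under eq_fun do rewrite -mulrA.
- rewrite /L2ip /innerL2 -Cintegral_conj; last exact: L2_cintegrable (L2T_L2 _) (L2T_L2 _).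
  by congr Cintegral; apply/funext => x; rewrite rmorphM /= conjCK mulrC.
- by apply: Cintegral_ge0 => x; rewrite mul_conj ler0c sqr_ge0.
Qed.

Lemma normL2_ipnorm (f : L2T) : normL2 f = ipnorm L2ip f.
Proof.
rewrite /normL2 /ipnorm /L2ip /innerL2 /Cintegral /=; congr Num.sqrt.
by apply: eq_Rintegral => x _; rewrite mul_conj.
Qed.

Lemma ipnorm_sqrE (f : L2T) :
  ((ipnorm L2ip f ^+ 2)%:E = \int[lam]_x (cabs (f x) ^+ 2)%:E)%E.
Proof.
rewrite -normL2_ipnorm /normL2 sqr_sqrtr; last first.
  by apply: Rintegral_ge0 => // x _; rewrite sqr_ge0.
rewrite /Rintegral fineK//; apply: integrable_fin_num => //.
exact: L2_integrable (L2T_L2 f).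
Qed.

Lemma measurable_cabs_sqrE (f : L2T) :
  measurable_fun setT (fun x => (cabs (f x) ^+ 2)%:E).
Proof.
apply/measurable_EFinP; apply: (@measurable_cabs_sqr _ _ f).
by case: (L2T_L2 f).
Qed.

Lemma ipnorm_ae0 (f : L2T) : ipnorm L2ip f = 0 -> ae_eq lam setT f (cst 0).
Proof.
move=> f0; have := ipnorm_sqrE f; rewrite f0 expr0n/= => /esym.
move=> If0.
have : (\int[lam]_x `|(cabs (f x) ^+ 2)%:E| = 0)%E.
  by rewrite -[RHS]If0; apply: eq_integral => x _; rewrite /= ger0_norm ?sqr_ge0.
move=> /(ae_eq_integral_abs lam measurableT (measurable_cabs_sqrE f)).
move=> [N [mN N0 H]]; exists N; split => // x /= nf; apply: H => /= nf'.
apply: nf => _; have [] := nf' I => /eqP.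
by rewrite sqrf_eq0 => /eqP c0; apply/eqP; rewrite -normr_eq0 normc_cabs c0.
Qed.

Lemma ipnorm_ae_eq (f g : L2T) : ae_eq lam setT f g ->
  ipnorm L2ip (f - g) = 0.
Proof.
move=> fg; apply/eqP; rewrite -sqrf_eq0; apply/eqP.
have -> : 0 = fine (0 : \bar R)%E :> R by [].
rewrite -[LHS]/(fine (_ ^+ 2)%:E) ipnorm_sqrE; congr fine.
rewrite -[RHS](@integral0 _ _ _ lam setT).
apply: ae_eq_integral => //.
  exact: (measurable_cabs_sqrE (f - g)).
case: fg => N [mN N0 H]; exists N; split => // x /= nf; apply: H => /= nf'.
apply: nf => _; rewrite -[(L2val f - L2val g) x]/(f x - g x) nf'// subrr.
by rewrite cabs_sqr /= expr0n addr0.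
Qed.

End L2_space.

(** * Completeness of L^2 *)

Section L2_complete.
Context {R : realType} {d : nat}.
Local Notation T := (d.-tuple (measurableTypeR R)).
Local Notation lam := (lebesgueT d : measure _ R).
Local Notation ipnorm := (ipnorm (@L2ip R d)).

Lemma measurable_cabs (f : T -> R[i]) : Cmeasurable f ->
  measurable_fun setT (fun x => cabs (f x)).
Proof.
move=> mf; have -> : (fun x => cabs (f x)) = Num.sqrt \o (fun x => cabs (f x) ^+ 2).
  by apply/funext => x /=; rewrite sqrtr_sqr ger0_norm// cabs_ge0.
apply: measurableT_comp; last exact: measurable_cabs_sqr.
exact: (continuous_measurable_fun (@sqrt_continuous R)).
Qed.

(** The sum of the absolute differences has a finite integral, hence is finite almost everywhere,
    and there the telescoping series converges absolutely. *)
Lemma ae_cvg_of_summable (f : nat -> T -> R) :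
  (forall n, measurable_fun setT (f n)) ->
  (forall n, (\int[lam]_x (`|f n.+1 x - f n x|)%:E <= (2 ^- n)%:E)%E) ->
  exists2 g : T -> R, measurable_fun setT g &
    \forall x \ae lam, (fun n => f n x) @ \oo --> g x.
Proof.
move=> mf fB.
pose h n x := (`|f n.+1 x - f n x|)%:E : \bar R.
have mh n : measurable_fun setT (h n).
  apply/measurable_EFinP/measurableT_comp => //.
  exact: measurable_funB.
pose G x := (\sum_(0 <= n <oo) h n x)%E.
have G0 x : (0 <= G x)%E by apply: nneseries_ge0 => n _ _; rewrite lee_fin.
have mG : measurable_fun setT G.
  by apply: (ge0_emeasurable_sum (h := h) (P := xpredT)) => // k x _ _; rewrite lee_fin.
have GI : (\int[lam]_x G x < +oo)%E.
  rewrite integral_nneseries//; last by move=> n x _; rewrite lee_fin.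
  apply: (@le_lt_trans _ _ 2%:E); last by rewrite ltry.
  (* The bound [2 ^- n] is read as [2 / 2 ^ n.+1]; these sum to at most 2. *)
  apply: (le_trans _ (@epsilon_trick0 _ 2 xpredT _)) => //.
  apply: lee_nneseries => n _; first by move=> _; apply: integral_ge0 => x _; rewrite lee_fin.
  apply: (le_trans (fB n)); rewrite lee_fin natrX exprS invfM mulrA.
  by rewrite divff ?mul1r// pnatr_eq0.
have /integrable_ae : lam.-integrable setT G.
  apply/integrableP; split; first exact: mG.
  by rewrite (eq_integral G)// => x _; rewrite gee0_abs.
move=> /(_ measurableT) Gfin.
(* The upper limit is measurable everywhere, even where the sequence diverges. *)
exists (fun x => fine (limn_esup (fun n => (f n x)%:E))).
  apply: measurableT_comp => //; apply: measurable_fun_limn_esup => n.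
  exact/measurable_EFinP.
apply: filterS Gfin => x /(_ I) Gx.
have : cvgn (fun n => f n x).
  have : cvgn (series (telescope (fun n => f n x))).
    apply: normed_cvg; apply: nnseries_is_cvg => [i|]; first exact: normr_ge0.
    by move: Gx; rewrite ge0_fin_numE.
  rewrite telescopeK => /(is_cvgD (is_cvg_cst (f 0%N x))).
  by under [X in cvgn X]eq_fun do rewrite /= addrC subrK.
move=> cf; have cE : (fun n => (f n x)%:E) @ \oo --> (limn (fun n => f n x))%:E.
  by apply: cvg_EFin; [exact: nearW|exact: cf].
by rewrite (cvg_limn_einf_sup cE).2.
Qed.

(** Young's inequality [|w| <= t / 2 + |w|^2 / (2 t)] integrates to at most [t], the total mass
    being 1. *)
Lemma L2_integral_cabs_le (w : L2T) t : 0 < t -> ipnorm w <= t ->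
  (\int[lam]_x (cabs (w x))%:E <= t%:E)%E.
Proof.
move=> t0 wt; have [mw _] := L2T_L2 w.
have mc : measurable_fun setT (fun x => cabs (w x)).
  exact: measurable_cabs.
have i2 : lam.-integrable setT (fun x => ((2 * t)^-1 * cabs (w x) ^+ 2)%:E).
  exact/integrable_funZl/L2_integrable/L2T_L2.
apply: (@le_trans _ _ (\int[lam]_x (t / 2 + (2 * t)^-1 * cabs (w x) ^+ 2)%:E)%E).
  apply: ge0_le_integral => //.
  - by move=> x _; rewrite lee_fin cabs_ge0.
  - exact/measurable_EFinP.
  - apply/measurable_EFinP/measurable_funD => //.
    by apply/measurable_EFinP; case/integrableP: i2.
  - move=> x _; rewrite lee_fin -subr_ge0.
    have -> : t / 2 + (2 * t)^-1 * cabs (w x) ^+ 2 - cabs (w x) =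
      (2 * t)^-1 * (t - cabs (w x)) ^+ 2 by field; rewrite gt_eqF.
    by rewrite mulr_ge0 ?sqr_ge0// invr_ge0 mulr_ge0// ltW.
have E : (\int[lam]_x (t / 2 + (2 * t)^-1 * cabs (w x) ^+ 2)%:E =
    (t / 2)%:E + ((2 * t)^-1)%:E * (ipnorm w ^+ 2)%:E)%E.
  rewrite ipnorm_sqrE -integralZl//; last exact: L2_integrable (L2T_L2 w).
  under [in LHS]eq_integral do rewrite EFinD.
  rewrite integralD//; last exact: finite_measure_integrable_cst.
  rewrite integral_cst//; congr (_ + _)%E; rewrite -[RHS]mule1.
  by congr (_ * _)%E; exact: probability_setT.
rewrite E -EFinM -EFinD lee_fin.
have tE : t / 2 + (2 * t)^-1 * t ^+ 2 = t by field; rewrite gt_eqF.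
rewrite -[X in _ <= X]tE lerD2l ler_wpM2l ?invr_ge0 ?mulr_ge0 ?(ltW t0)//.
by rewrite ler_pXn2r ?nnegrE ?ipnorm_ge0// ltW.
Qed.

(** Real and imaginary parts converge almost everywhere; Fatou's lemma then turns the geometric
    bounds on the differences into bounds on the distance to the limit. *)
Lemma L2_complete (v : nat -> L2T) :
  (forall n, ipnorm (v n.+1 - v n) <= 2 ^- n) ->
  exists w, ipnorm (v n - w) @[n --> \oo] --> 0.
Proof.
move=> vB.
have p2 n : 0 < 2 ^- n :> R by rewrite invr_gt0 exprn_gt0.
have vI n := L2_integral_cabs_le (p2 n) (vB n).
have mv n : Cmeasurable (v n) by case: (L2T_L2 (v n)).
have mvd n : Cmeasurable (v n.+1 - v n) by case: (L2T_L2 (v n.+1 - v n)).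
have part (p : R[i] -> R) : (forall x y, p (x - y) = p x - p y) ->
    (forall z, `|p z| <= cabs z) ->
    (forall n, measurable_fun setT (fun x => p (v n x))) ->
    exists2 g : T -> R, measurable_fun setT g &
    \forall x \ae lam, (fun n => p (v n x)) @ \oo --> g x.
  move=> pB ple mp; apply: ae_cvg_of_summable => // n.
  apply: le_trans (vI n); apply: ge0_le_integral => //.
  - apply/measurable_EFinP/measurableT_comp => //.
    exact: measurable_funB.
  - by apply/measurable_EFinP; exact: measurable_cabs.
  - by move=> x _; rewrite lee_fin -pB; exact: ple.
have [|||g1 mg1 cg1] := part Re.
- by case=> [? ?] [? ?].
- exact: norm_Re_le.
- by move=> n; case: (mv n).
have [|||g2 mg2 cg2] := part Im.
- by case=> [? ?] [? ?].
- exact: norm_Im_le.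
- by move=> n; case: (mv n).
pose g x := Complex (g1 x) (g2 x).
have mg : Cmeasurable g by split.
have geo n m : ipnorm (v n - v (m + n)%N) <= 2 * 2 ^- n.
  rewrite (ipnormB_sym L2ip_semi_inner).
  (* The subtracted tail makes the bound provable by induction: it drops by exactly [2 ^- (m + n)]
     at each step. *)
  suff : ipnorm (v (m + n)%N - v n) <= 2 * 2 ^- n - 2 * 2 ^- (m + n).
    by move=> /le_trans; apply; rewrite lerBlDr lerDl mulr_ge0// ltW.
  elim: m => [|m IH]; first by rewrite add0n !subrr (ipnorm0 L2ip_semi_inner).
  apply: le_trans (ipnormB_tri L2ip_semi_inner _ (v (m + n)%N) _) _.
  rewrite addSn; apply: le_trans (lerD (vB _) IH) _.
  rewrite exprS invfM mulrA divff ?mul1r// ?pnatr_eq0//; lra.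
have fat n : (\int[lam]_x (cabs (v n x - g x) ^+ 2)%:E <= ((2 * 2 ^- n) ^+ 2)%:E)%E.
  pose F m x := (cabs (v n x - v (m + n)%N x) ^+ 2)%:E : \bar R.
  have mF m : measurable_fun setT (F m).
    exact: (measurable_cabs_sqrE (v n - v (m + n)%N)).
  have -> : (\int[lam]_x (cabs (v n x - g x) ^+ 2)%:E =
      \int[lam]_x limn_einf (F^~ x))%E.
    apply: ae_eq_integral => //.
    - apply/measurable_EFinP; apply: (@measurable_cabs_sqr _ _ (fun x => v n x - g x)).
      apply: CmeasurableD => //.
      by under eq_fun do rewrite -mulN1r; apply: CmeasurableM => //; exact: Cmeasurable_cst.
    - apply: (emeasurable_fun_cvg (fun m x => einfs (F^~ x) m)) => [m|x _].
        exact: measurable_fun_einfs.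
      by rewrite limn_einf_lim; exact: is_cvg_einfs.
    - apply: filterS2 cg1 cg2 => x c1 c2 _; apply/esym.
      suff cE : F^~ x @ \oo --> (cabs (v n x - g x) ^+ 2)%:E.
        by rewrite (cvg_limn_einf_sup cE).1.
      apply: cvg_EFin; first exact: nearW.
      have -> : fine \o F^~ x = fun m => (Re (v n x) - Re (v (m + n)%N x)) ^+ 2 +
          (Im (v n x) - Im (v (m + n)%N x)) ^+ 2.
        apply/funext => m; rewrite /F /= cabs_sqr.
        by case: (v n x) (v (m + n)%N x) => [? ?] [? ?].
      rewrite cabs_sqr.
      have -> : Re (v n x - g x) = Re (v n x) - g1 x by case: (v n x).
      have -> : Im (v n x - g x) = Im (v n x) - g2 x by case: (v n x).
      have sh (h : nat -> R) l : h @ \oo --> l -> (fun m => h (m + n)%N) @ \oo --> l.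
        by move=> hl; rewrite (cvg_shiftn n).
      apply: cvgD; apply: cvgM; apply: cvgB;
        by [exact: cvg_cst|exact: sh c1|exact: sh c2].
  apply: le_trans (fatou _ _ _ _) _ => //.
    by move=> m x _; rewrite lee_fin sqr_ge0.
  rewrite limn_einf_lim; apply: lime_le; first exact: is_cvg_einfs.
  apply: nearW => m; apply: (@le_trans _ _ (\int[lam]_x F m x)%E).
    by apply: ereal_inf_lbound; exists m => /=.
  rewrite -(ipnorm_sqrE (v n - v (m + n)%N)) lee_fin.
  by rewrite ler_pXn2r ?nnegrE ?ipnorm_ge0 ?mulr_ge0 ?(ltW (p2 _)).
have g2' : L2 g.
  have g0 : L2 (fun x => v 0%N x - g x).
    split.
      apply: CmeasurableD => //; under eq_fun do rewrite -mulN1r.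
      by apply: CmeasurableM => //; exact: Cmeasurable_cst.
    under eq_integral do rewrite mulr1.
    by apply: le_lt_trans (fat 0%N) _; rewrite ltry.
  have := L2D (L2T_L2 (v 0%N)) (L2Z (-1) g0).
  by under eq_fun do rewrite mulN1r opprB addrC subrK.
exists (toL2 g2'); apply/cvgr0Pnorm_le => eps eps0.
have cv : (fun n => 2 * 2 ^- n : R) @ \oo --> 0.
  rewrite -(mulr0 (2 : R)); apply: cvgM; first exact: cvg_cst.
  under eq_fun do rewrite -exprVn.
  by apply: cvg_expr; rewrite gtr0_norm ?invr_gt0// invf_lt1// ltr1n.
apply: filterS (cvgr0_norm_le _ cv _ eps0) => n.
rewrite !ger0_norm ?ipnorm_ge0 ?mulr_ge0 ?(ltW (p2 _))//; apply: le_trans.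
rewrite -(@ler_pXn2r _ 2)// ?nnegrE ?ipnorm_ge0 ?mulr_ge0 ?(ltW (p2 _))//.
by rewrite -lee_fin ipnorm_sqrE; exact: fat.
Qed.

End L2_complete.

(** * Completeness of the exponentials *)

Section sign_iteration.
Context {R : realType}.
Implicit Types s : R.

(* An odd polynomial whose iterates converge to the sign function on [-1, 1]. *)
Definition sgn_step s := s * (3 - s ^+ 2) / 2.

Lemma sgn_stepN s : sgn_step (- s) = - sgn_step s.
Proof. by rewrite /sgn_step sqrrN !mulNr. Qed.

Lemma iter_sgn_stepN n s : iter n sgn_step (- s) = - iter n sgn_step s.
Proof. by elim: n => //= n ->; rewrite sgn_stepN. Qed.

(** [1 - sgn_step t = (1 - t) * (1 - (t + t ^+ 2) / 2)], and the iterates never fall below [s]; so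
    each step shrinks the distance to 1 by the factor [1 - s / 2] at least. *)
Lemma iter_sgn_step_bound n s : 0 < s <= 1 ->
  s <= iter n sgn_step s <= 1 /\ 1 - iter n sgn_step s <= (1 - s / 2) ^+ n.
Proof.
move=> /andP[s0 s1]; elim: n => [|n /= [/andP[sn sn1] IH]].
  by rewrite /= lexx s1 expr0 lerBlDr lerDl ltW.
move: sn sn1 IH; set t := iter n _ _ => st t1 IH.
have tE : 1 - sgn_step t = (1 - t) * (1 - (t + t ^+ 2) / 2).
  by rewrite /sgn_step; field.
have tE' : sgn_step t = t + t * (1 - t ^+ 2) / 2 by rewrite /sgn_step; field.
have t21 : t ^+ 2 <= 1 by rewrite expr_le1 ?(le_trans (ltW s0)).
have t0 : 0 <= t by rewrite (le_trans (ltW s0)).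
have t1' : 0 <= 1 - (t + t ^+ 2) / 2.
  by rewrite subr_ge0 ler_pdivrMr// mul1r (le_trans (lerD t1 t21)).
split; first (apply/andP; split).
- by rewrite tE' (le_trans st)// lerDl divr_ge0// mulr_ge0// subr_ge0.
- by rewrite -subr_ge0 tE mulr_ge0// subr_ge0.
- rewrite tE [_ ^+ n.+1]exprSr; apply: ler_pM => //; first by rewrite subr_ge0.
  rewrite lerD2l lerN2 ler_pM2r ?invr_gt0//.
  by rewrite (le_trans st)// lerDl sqr_ge0.
Qed.

Lemma iter_sgn_step_le1 n s : `|s| <= 1 -> `|iter n sgn_step s| <= 1.
Proof.
wlog s0 : s / 0 <= s => [H|].
  have [/H//|/ltW s0 s1] := leP 0 s.
  by rewrite -normrN -iter_sgn_stepN; apply: H; rewrite ?oppr_ge0 ?normrN.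
rewrite ger0_norm// => s1; move: s0; rewrite le_eqVlt => /orP[/eqP <-|s0].
  suff -> : iter n sgn_step 0 = 0 :> R by rewrite normr0.
  by elim: n => //= n ->; rewrite /sgn_step !mul0r.
have [|/andP[sn sn1] _] := @iter_sgn_step_bound n s; first by rewrite s0.
by rewrite ger0_norm// (le_trans (ltW s0)).
Qed.

Lemma cvg_iter_sgn_step s : `|s| <= 1 ->
  (fun n => iter n sgn_step s) @ \oo --> Num.sg s.
Proof.
wlog s0 : s / 0 < s => [H s1|].
  have [s0|s0|s0] := ltgtP 0 s.
  - exact: H.
  - rewrite -[s]opprK sgrN; under eq_cvg do rewrite iter_sgn_stepN.
    by apply: cvgN; apply: H; rewrite ?oppr_gt0 ?normrN.
  - rewrite -s0 sgr0.
    suff E n : iter n sgn_step 0 = 0 :> R.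
      by under eq_cvg do rewrite E; exact: cvg_cst.
    by elim: n => //= n ->; rewrite /sgn_step !mul0r.
rewrite gtr0_norm// => s1; rewrite gtr0_sg//.
have B n := @iter_sgn_step_bound n s.
have c : (fun n => 1 - iter n sgn_step s) @ \oo --> 0.
  have q1 : `|1 - s / 2| < 1.
    by rewrite ger0_norm; lra.
  apply: (squeeze_cvgr _ (cvg_cst 0) (cvg_expr q1)).
  apply: nearW => n; have [|/andP[_ sn1] le] := B n; first by rewrite s0.
  by rewrite le subr_ge0 sn1.
have -> : (fun n => iter n sgn_step s) = (fun n => 1 - (1 - iter n sgn_step s)).
  by apply/funext => n; rewrite opprB addrC subrK.
by rewrite -[X in _ --> X](subr0 (1 : R)); apply: cvgB => //; exact: cvg_cst.
Qed.

End sign_iteration.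

(** * Bounded limits of trigonometric polynomials *)

Section trigonometric_class.
Context {R : realType} {d : nat}.
Local Notation T := (d.-tuple (measurableTypeR R)).
Local Notation Zd := 'rV[int]_d.
Local Notation lam := (lebesgueT d : measure _ R).

Definition angle (k : Zd) (x : T) : R :=
  2 * pi * (\sum_(i < d) (k ord0 i)%:~R * tnth x i).

Lemma angleD k l x : angle (k + l) x = angle k x + angle l x.
Proof.
rewrite /angle -mulrDr -big_split/=; congr (_ * _); apply: eq_bigr => i _.
by rewrite mxE rmorphD mulrDl.
Qed.

Lemma angleN k x : angle (- k) x = - angle k x.
Proof.
rewrite /angle -mulrN -sumrN; congr (_ * _); apply: eq_bigr => i _.
by rewrite mxE rmorphN mulNr.
Qed.

Lemma angle0 x : angle 0 x = 0.
Proof. by rewrite /angle big1 ?mulr0// => i _; rewrite mxE mul0r. Qed.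

Lemma angle_delta i x : angle (delta_mx 0 i) x = 2 * pi * tnth x i.
Proof.
rewrite /angle (bigD1 i)//= mxE !eqxx mul1r big1 ?addr0// => j /negbTE ji.
by rewrite mxE ji andbF mul0r.
Qed.

(* Closing under bounded pointwise limits in one step (rather than taking limits of
   polynomials once) makes the class stable under products by induction. *)
Inductive trig_class : (T -> R) -> Prop :=
| trig_cos k : trig_class (fun x => cos (angle k x))
| trig_sin k : trig_class (fun x => sin (angle k x))
| trig_lin a f g : trig_class f -> trig_class g ->
    trig_class (fun x => a * f x + g x)
| trig_lim (f_ : nat -> T -> R) f M : (forall n, trig_class (f_ n)) ->
    (forall n x, `|f_ n x| <= M) ->
    (forall x, (fun n => f_ n x) @ \oo --> f x) -> trig_class f.

Lemma trig_cst c : trig_class (fun=> c).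
Proof.
have := trig_lin (c - 1) (trig_cos 0) (trig_cos 0).
by under eq_fun do rewrite angle0 cos0 mulr1 subrK.
Qed.

Lemma trigZ a f : trig_class f -> trig_class (fun x => a * f x).
Proof.
move=> cf; have := trig_lin a cf (trig_cst 0).
by under eq_fun do rewrite addr0.
Qed.

Lemma trigD f g : trig_class f -> trig_class g -> trig_class (fun x => f x + g x).
Proof.
by move=> cf cg; have := trig_lin 1 cf cg; under eq_fun do rewrite mul1r.
Qed.

Lemma trigB f g : trig_class f -> trig_class g -> trig_class (fun x => f x - g x).
Proof.
move=> cf /(trigZ (-1)) /(trigD cf); by under eq_fun do rewrite mulN1r.
Qed.

Lemma trig_bounded f : trig_class f -> exists M, forall x, `|f x| <= M.
Proof.
elim=> [k|k|a {}f g _ [M HM] _ [N HN]|f_ {}f M _ _ HM fl].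
- by exists 1 => x; exact: cos_max.
- by exists 1 => x; exact: sin_max.
- exists (`|a| * M + N) => x; rewrite (le_trans (ler_normD _ _))// lerD// normrM.
  exact: ler_wpM2l.
- exists M => x; have nf : (fun n => `|f_ n x|) @ \oo --> `|f x| by exact: cvg_norm.
  rewrite -(cvg_lim _ nf)//; apply: limr_le; first by apply/cvg_ex; exists `|f x|.
  exact: nearW.
Qed.

Lemma trig_measurable f : trig_class f -> measurable_fun setT f.
Proof.
have ma k : measurable_fun setT (angle k).
  apply: measurable_funM => //; apply: measurable_sum => i.
  apply: measurable_funM => //; exact: measurable_tnth.
elim=> [k|k|a {}f g _ mf _ mg|f_ {}f M _ mf HM fl].
- apply: (measurableT_comp _ (ma k)).
  exact: (continuous_measurable_fun (@continuous_cos R)).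
- apply: (measurableT_comp _ (ma k)).
  exact: (continuous_measurable_fun (@continuous_sin R)).
- by apply: measurable_funD => //; exact: measurable_funM.
- by apply: (measurable_fun_cvg mf) => x _; exact: fl.
Qed.

(** First of the two inductions behind [trigM]: one factor is a basis function, and the
    product-to-sum formulas settle the base cases. *)
Lemma trig_mul_basis g : trig_class g -> forall k,
  trig_class (fun x => cos (angle k x) * g x) /\
  trig_class (fun x => sin (angle k x) * g x).
Proof.
elim=> [l|l|a {}f {}g cf Hf cg Hg|f_ {}f M cf Hf HM fl] k.
- split.
  + have := trigZ 2^-1 (trigD (trig_cos (k + l)) (trig_cos (k - l))).
    congr trig_class; apply/funext => x.
    by rewrite !angleD angleN cosD cosD cosN sinN; field.
  + have := trigZ 2^-1 (trigD (trig_sin (k + l)) (trig_sin (k - l))).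
    congr trig_class; apply/funext => x.
    by rewrite !angleD angleN sinD sinD cosN sinN; field.
- split.
  + have := trigZ 2^-1 (trigB (trig_sin (k + l)) (trig_sin (k - l))).
    congr trig_class; apply/funext => x.
    by rewrite !angleD angleN sinD sinD cosN sinN; field.
  + have := trigZ 2^-1 (trigB (trig_cos (k - l)) (trig_cos (k + l))).
    congr trig_class; apply/funext => x.
    by rewrite !angleD angleN cosD cosD cosN sinN; field.
- have [f1 f2] := Hf k; have [g1 g2] := Hg k; split.
  + have := trig_lin a f1 g1; congr trig_class; apply/funext => x; ring.
  + have := trig_lin a f2 g2; congr trig_class; apply/funext => x; ring.
- split.
  + apply: (trig_lim (f_ := fun n x => cos (angle k x) * f_ n x) (M := M)).
    * by move=> n; have [] := Hf n k.
    * move=> n x; rewrite normrM (le_trans _ (HM n x))//.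
      by rewrite ler_piMl// cos_max.
    * by move=> x; apply: cvgM => //; exact: cvg_cst.
  + apply: (trig_lim (f_ := fun n x => sin (angle k x) * f_ n x) (M := M)).
    * by move=> n; have [] := Hf n k.
    * move=> n x; rewrite normrM (le_trans _ (HM n x))//.
      by rewrite ler_piMl// sin_max.
    * by move=> x; apply: cvgM => //; exact: cvg_cst.
Qed.

(** Second induction, on [f] with [g] arbitrary; in the limit case the bound on [g] from
    [trig_bounded] keeps the products bounded. *)
Lemma trigM f g : trig_class f -> trig_class g -> trig_class (fun x => f x * g x).
Proof.
move=> + cg; elim=> [k|k|a {}f h cf Hf ch Hh|f_ {}f M cf Hf HM fl].
- by have [] := trig_mul_basis cg k.
- by have [] := trig_mul_basis cg k.
- have := trig_lin a Hf Hh; congr trig_class; apply/funext => x; ring.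
- have [N HN] := trig_bounded cg.
  apply: (trig_lim (f_ := fun n x => f_ n x * g x) (M := M * N)) => //.
  + by move=> n x; rewrite normrM ler_pM.
  + by move=> x; apply: cvgM => //; exact: cvg_cst.
Qed.

Lemma trig_sg f : trig_class f -> trig_class (fun x => Num.sg (f x)).
Proof.
move=> cf; have [M0 HM0] := trig_bounded cf.
(* The iterates of [sgn_step] are controlled only on [-1, 1]; dividing by a positive constant does
   not change the sign. *)
pose M := `|M0| + 1; have Mgt0 : 0 < M by rewrite ltr_wpDl.
have HM x : `|M^-1 * f x| <= 1.
  rewrite normrM gtr0_norm ?invr_gt0// mulrC ler_pdivrMr// mul1r.
  by rewrite (le_trans (HM0 x))// (le_trans (ler_norm _))// lerDl.
have -> : (fun x => Num.sg (f x)) = (fun x => Num.sg (M^-1 * f x)).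
  by apply/funext => x; rewrite sgrM (@gtr0_sg _ M^-1) ?invr_gt0// mul1r.
apply: (trig_lim (f_ := fun n x => iter n sgn_step (M^-1 * f x)) (M := 1)).
- elim=> [|n IH] /=; first exact: trigZ.
  have -> : (fun x => sgn_step (iter n sgn_step (M^-1 * f x))) = fun x =>
     2^-1 * (iter n sgn_step (M^-1 * f x) * (3 -
      iter n sgn_step (M^-1 * f x) * iter n sgn_step (M^-1 * f x))).
    by apply/funext => x; rewrite /sgn_step; field.
  apply: trigZ; apply: trigM => //; apply: trigB; [exact: trig_cst|exact: trigM].
- by move=> n x; exact: iter_sgn_step_le1.
- by move=> x; exact: cvg_iter_sgn_step.
Qed.

End trigonometric_class.

(** * Measurable sets whose indicators are trigonometric limits *)

Section trigonometric_sets.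
Context {R : realType} {d : nat}.
Local Notation T := (d.-tuple (measurableTypeR R)).
Local Notation lam := (lebesgueT d : measure _ R).

Definition trig_set (E : set T) := trig_class (\1_E : T -> R).

Lemma trig_setC E : trig_set E -> trig_set (~` E).
Proof.
move=> cE; have := trigB (trig_cst 1) cE; congr trig_class; apply/funext => x.
by rewrite !indicE in_setC; case: (x \in E); rewrite ?subrr ?subr0.
Qed.

Lemma trig_setT : trig_set setT.
Proof. by have := @trig_cst R d 1; rewrite /trig_set indicT. Qed.

Lemma trig_set0 : trig_set set0.
Proof. by rewrite -setCT; exact/trig_setC/trig_setT. Qed.

Lemma trig_setI E F : trig_set E -> trig_set F -> trig_set (E `&` F).
Proof.
move=> cE cF; have := trigM cE cF; congr trig_class; apply/funext => x.
by rewrite !indicE in_setI; case: (x \in E); rewrite ?mul0r ?mul1r.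
Qed.

Lemma trig_setU E F : trig_set E -> trig_set F -> trig_set (E `|` F).
Proof.
by move=> cE cF; rewrite -[_ `|` _]setCK setCU; apply/trig_setC/trig_setI;
  exact: trig_setC.
Qed.

Lemma trig_bigcup (A : nat -> set T) : (forall n, trig_set (A n)) ->
  trig_set (\bigcup_n A n).
Proof.
move=> cA.
apply: (trig_lim (f_ := fun n => \1_(\big[setU/set0]_(i < n) A i)) (M := 1)).
- elim=> [|n IH]; first by rewrite big_ord0; exact: trig_set0.
  by rewrite big_ord_recr; exact: trig_setU.
- by move=> n x; rewrite indicE; case: (_ \in _); rewrite ?normr1 ?normr0.
- move=> x; rewrite indicE; case: (boolP (x \in _)) => [|/negP] xA.
    move: xA; rewrite inE => -[k _ Akx].
    apply: cvg_near_cst; exists k.+1 => // n /= kn; rewrite indicE mem_set// -bigcup_mkord.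
    by exists k.
  apply: cvg_near_cst; apply: nearW => n; rewrite indicE memNset// -bigcup_mkord.
  by move=> [k _ Akx]; apply: xA; rewrite inE; exists k.
Qed.

Lemma trig_set_gt0 f : trig_class f -> trig_set [set x | 0 < f x].
Proof.
(* With [s] the sign of [f x], the indicator is [(s + s ^+ 2) / 2]. *)
move=> /trig_sg cf; have := trigZ 2^-1 (trigD cf (trigM cf cf)).
congr trig_class; apply/funext => x; rewrite indicE.
have [fx|fx|fx] := ltgtP 0 (f x).
- by rewrite gtr0_sg// mem_set//=; field.
- by rewrite ltr0_sg// memNset/= ?ltNge ?(ltW fx)//; field.
- by rewrite -fx sgr0 memNset/= -?fx ?ltxx//; field.
Qed.

Definition torus_dom : set T := [set x | forall i, `[0, 1[%classic (tnth x i)].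

(** Functions in [trig_class] are periodic, so a measurable set of tuples can be matched only on the
    fundamental domain. *)
Definition periodic_sets : set (set T) :=
  [set E | exists2 E', trig_set E' & E `&` torus_dom = E' `&` torus_dom].

Lemma sigma_algebra_periodic_sets : sigma_algebra setT periodic_sets.
Proof.
split=> [|A [A' cA' AA']|A HA].
- by exists set0 => //; exact: trig_set0.
- exists (~` A'); first exact: trig_setC.
  rewrite setTD; apply/seteqP; split => x [nA Dx]; split => // Ax; apply: nA.
    by have [] : (A `&` torus_dom) x by rewrite AA'.
  by have [] : (A' `&` torus_dom) x by rewrite -AA'.
- have HA2 n : exists E, trig_set E /\ A n `&` torus_dom = E `&` torus_dom.
    by have [E cE AE] := HA n; exists E.
  have [A' HA'] := choice HA2.
  exists (\bigcup_n A' n); first by apply: trig_bigcup => n; case: (HA' n).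
  by rewrite !setI_bigcupl; apply: eq_bigcupr => n _; case: (HA' n).
Qed.

(** On the circle, [0, a] is the arc with centre at angle [pi * a] and half-width [pi * a]. Points
    outside it are farther from the centre, so their cosine is smaller. *)
Lemma cos_arc (a x : R) : 0 <= a < 1 -> 0 <= x < 1 ->
  (a < x) = (cos (2 * pi * x - pi * a) < cos (pi * a)).
Proof.
move=> /andP[a0 a1] /andP[x0 x1].
have p0 := pi_gt0 R.
have pa : pi * a \in `[0, pi]%R by rewrite in_itv/=; apply/andP; split; nra.
have [xa|ax] := leP x a.
  apply/esym/negbTE; rewrite -leNgt -(cos_norm (_ - _)).
  set t := `|_|; have [t0 tpa] : 0 <= t /\ t <= pi * a.
    by split; rewrite ?normr_ge0// ler_norml; apply/andP; split; nra.
  rewrite leNgt ltr_cos// ?in_itv/=; last first.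
    by rewrite t0 /=; move: pa; rewrite in_itv/= => /andP[_]; exact: le_trans.
  by rewrite -leNgt.
have [t1|t1] := leP (2 * pi * x - pi * a) pi.
  rewrite ltr_cos//; first by apply/esym; nra.
  by rewrite in_itv/= t1 andbT; nra.
(* An angle [t] beyond [pi] is reflected to [2 * pi - t], back where the cosine decreases. *)
rewrite -(cosN (_ - _)) -(cosD2pi (- _)).
rewrite ltr_cos// ?in_itv/=.
  by apply/esym; rewrite mulr2n; nra.
by rewrite mulr2n; apply/andP; split; nra.
Qed.

(** For [a] outside [0, 1[ the trace on the domain is everything or nothing; otherwise [cos_arc]
    describes it by the sign of a trigonometric polynomial. *)
Lemma periodic_halfspace i (a : R) :
  periodic_sets [set x | tnth x i \in `]a, +oo[].
Proof.
have [a0|a0] := ltP a 0.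
  exists setT; first exact: trig_setT.
  apply/seteqP; split => x [] //= _ Dx; split => //; have := Dx i.
  by rewrite /= !in_itv/= andbT => /andP[x0 _]; exact: lt_le_trans x0.
have [a1|a1] := ltP a 1; last first.
  exists set0; first exact: trig_set0.
  apply/seteqP; split => x [] //= ax Dx; have := Dx i.
  move: ax; rewrite /= !in_itv/= andbT => ax /andP[_ x1].
  by have := lt_trans ax x1; rewrite ltNge a1.
pose f (x : T) := cos (pi * a) - cos (2 * pi * tnth x i - pi * a).
have cf : trig_class f.
  have := trigB (trig_cst (cos (pi * a))) (trigD
    (trigZ (cos (pi * a)) (trig_cos (delta_mx 0 i)))
    (trigZ (sin (pi * a)) (trig_sin (delta_mx 0 i)))).
  congr trig_class; apply/funext => x; rewrite /f cosB angle_delta; ring.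
exists [set x | 0 < f x]; first exact: trig_set_gt0.
apply/seteqP; split => x [] /= + Dx; have := Dx i;
  rewrite /= !in_itv/= andbT => xi h; split => //.
  by rewrite subr_gt0 -cos_arc// a0.
by move: h; rewrite subr_gt0 -cos_arc// a0.
Qed.

Lemma measurable_periodic_sets : measurable `<=` periodic_sets.
Proof.
move=> E mE.
(* Inclusion of sigma-algebras as measurability of the identity, which can be tested on rays in each
   coordinate. *)
have idm : measurable_fun setT (id : g_sigma_algebraType periodic_sets -> T).
  apply/measurable_fun_tnthP => i.
  apply: (measurability _ (RGenOInfty.measurableE R)) => //= _ [_ [a ->] <-].
  rewrite setTI; apply: sub_sigma_algebra; exact: periodic_halfspace.
have := idm measurableT E mE; rewrite setTI.
by apply: smallest_sub => //; exact: sigma_algebra_periodic_sets.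
Qed.

Lemma measurable_torus_dom : measurable torus_dom.
Proof.
rewrite (_ : torus_dom = \bigcap_(i in [set: 'I_d])
  ((fun x : T => tnth x i) @^-1` `[0, 1[)); last first.
  by apply/seteqP; split => x /= h i; [move=> _|]; exact: h.
apply: fin_bigcap_measurable => [|i _]; first exact: finite_finset.
by rewrite -[X in measurable X]setTI; exact: measurable_tnth.
Qed.

Lemma torus_dom_ae : lam (~` torus_dom) = 0%E.
Proof.
have D1 : lebesgueT d torus_dom = 1%E.
  rewrite /torus_dom (@lebesgueT_box _ d (fun=> `[0, 1[%classic))//.
  rewrite big1// => i _.
  by rewrite setIid lebesgue_measure_itv/= lte01 oppr0 adde0.
by have := probability_setC (lebesgueT d) measurable_torus_dom; rewrite D1 subee.
Qed.

End trigonometric_sets.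

(** * Functions with vanishing Fourier coefficients *)

Section totality.
Context {R : realType} {d : nat}.
Local Notation T := (d.-tuple (measurableTypeR R)).
Local Notation Zd := 'rV[int]_d.
Local Notation lam := (lebesgueT d : measure _ R).

Lemma integrable_bounded_mul (u f : T -> R) M :
  lam.-integrable setT (EFin \o u) -> measurable_fun setT f ->
  (forall x, `|f x| <= M) ->
  lam.-integrable setT (EFin \o (fun x => u x * f x)).
Proof.
move=> iu mf fM.
apply: (integrable_dom (k := fun x => M * `|u x|)).
- by apply: measurable_funM => //; apply/measurable_EFinP; case/integrableP: iu.
- by apply: integrable_funZl; have := integrable_norm iu.
- by move=> x; rewrite normrM mulrC ler_wpM2r.
Qed.

Section real_coefficients.
Variable u : T -> R.
Hypothesis iu : lam.-integrable setT (EFin \o u).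
Hypothesis u_cos : forall k, (\int[lam]_x (u x * cos (angle k x))%:E = 0)%E.
Hypothesis u_sin : forall k, (\int[lam]_x (u x * sin (angle k x))%:E = 0)%E.

Lemma trig_class_integral0 f : trig_class f ->
  (\int[lam]_x (u x * f x)%:E = 0)%E.
Proof.
have iuf g : trig_class g -> lam.-integrable setT (EFin \o (fun x => u x * g x)).
  move=> cg; have [M HM] := trig_bounded cg.
  by apply: integrable_bounded_mul HM => //; exact: trig_measurable.
elim=> [k|k|a {}f g cf f0 cg g0|f_ {}f M cf f0 HM fl]; [exact: u_cos|exact: u_sin|..].
- under eq_integral => x _.
    rewrite (_ : u x * _ = a * (u x * f x) + u x * g x); last by ring.
    rewrite EFinD EFinM; over.
  rewrite integralD//; [|exact/integrable_funZl/iuf|exact: iuf].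
  by rewrite integralZl//; [rewrite f0 g0 mule0 adde0|exact: iuf].
- have c : (fun n => \int[lam]_x (u x * f_ n x)%:E)%E @ \oo -->
      (\int[lam]_x (u x * f x)%:E)%E.
    apply: (@dominated_cvg _ _ _ _ _ _ _ _ (fun x => (M * `|u x|)%:E)) => //.
    + by move=> n; case/integrableP: (iuf _ (cf n)).
    + move=> x _; apply: cvg_EFin; first exact: nearW.
      by apply: cvgM; [exact: cvg_cst|exact: fl].
    + by apply: integrable_funZl; have := integrable_norm iu.
    + by move=> n x _; rewrite lee_fin normrM mulrC ler_wpM2r.
  rewrite -(cvg_lim _ c)//; under eq_fun do rewrite f0.
  exact: lim_cst.
Qed.

(** Every measurable [E] agrees with a [trig_set] off a null set, so [u] has integral zero over
    [E]. *)
Lemma ae_eq0_of_fourier : ae_eq lam setT (EFin \o u) (cst 0%E).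
Proof.
have mu_ : measurable_fun setT u by apply/measurable_EFinP; case/integrableP: iu.
apply: integral_ae_eq => // E _ mE; rewrite integral0.
have [E' cE' EE'] := measurable_periodic_sets mE.
have mE' : measurable_fun setT (\1_E' : T -> R) by exact: trig_measurable.
rewrite integral_mkcond -[RHS](trig_class_integral0 cE').
apply: ae_eq_integral => //.
- apply/(measurable_restrictT _ mE); case/integrableP: iu => + _; exact: measurable_funTS.
- by apply/measurable_EFinP; exact: measurable_funM.
exists (~` @torus_dom R d); split.
- by apply: measurableC; exact: measurable_torus_dom.
- exact: torus_dom_ae.
move=> x /= nE Dx; apply: nE => _; rewrite patchE indicE.
have -> : (x \in E) = (x \in E').
  apply/idP/idP; rewrite !inE => Ex.
    by have [] : (E' `&` torus_dom) x by rewrite -EE'.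
  by have [] : (E `&` torus_dom) x by rewrite EE'.
by case: (x \in E'); rewrite /= ?mulr1 ?mulr0.
Qed.

End real_coefficients.

Lemma expkE k (x : T) : expk k x = Complex (cos (angle k x)) (sin (angle k x)).
Proof. by []. Qed.

Lemma expkN k (x : T) : expk (- k) x = (expk k x)^*.
Proof. by rewrite !expkE angleN cosN sinN. Qed.

Lemma expkD k l (x : T) : expk (k + l) x = expk k x * expk l x.
Proof.
apply/eqP; rewrite eq_complex complex_ReM complex_ImM !expkE /=.
by rewrite angleD cosD sinD eqxx addrC eqxx.
Qed.

Lemma expk0 (x : T) : expk 0 x = 1.
Proof. by rewrite expkE angle0 cos0 sin0. Qed.

Lemma cabs_expk k (x : T) : cabs (expk k x) = 1.
Proof. by rewrite expkE cabsE /= cos2Dsin2 sqrtr1. Qed.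

Lemma Cmeasurable_expk k : Cmeasurable (@expk R d k).
Proof.
by split; [exact: (trig_measurable (trig_cos k))|exact: (trig_measurable (trig_sin k))].
Qed.

Lemma L2_expk k : L2 (@expk R d k).
Proof.
have := L2M_bounded (Cmeasurable_expk k) _ (@L2_cst R d 1).
by move=> /(_ 1); under eq_fun do rewrite mulr1; apply => x; rewrite cabs_expk.
Qed.

Definition expkT k : @L2T R d := toL2 (L2_expk k).

Lemma expkT_total (u : L2T) : (forall k, L2ip u (expkT k) = 0) ->
  ipnorm (@L2ip R d) u = 0.
Proof.
move=> u0.
pose a x := Re (u x); pose b x := Im (u x).
have [ia ib] : lam.-integrable setT (EFin \o a) /\ lam.-integrable setT (EFin \o b).
  have := L2_cintegrable (L2T_L2 u) (@L2_cst R d 1).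
  by under eq_fun do rewrite conjC1 mulr1; case.
have [ma mb] : measurable_fun setT a /\ measurable_fun setT b.
  by have [[]] := L2T_L2 u.
have mc k := trig_measurable (trig_cos (R := R) (d := d) k).
have ms k := trig_measurable (trig_sin (R := R) (d := d) k).
have bc (k : Zd) (x : T) : `|cos (angle k x) : R| <= 1 by exact: cos_max.
have bs (k : Zd) (x : T) : `|sin (angle k x) : R| <= 1 by exact: sin_max.
have iac k := integrable_bounded_mul ia (mc k) (bc k).
have ias k := integrable_bounded_mul ia (ms k) (bs k).
have ibc k := integrable_bounded_mul ib (mc k) (bc k).
have ibs k := integrable_bounded_mul ib (ms k) (bs k).
pose J (f : T -> R) := (\int[lam]_x f x)%R.
have E k : J (fun x => a x * cos (angle k x)) + J (fun x => b x * sin (angle k x)) = 0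
    /\ J (fun x => b x * cos (angle k x)) - J (fun x => a x * sin (angle k x)) = 0.
  have := u0 k; rewrite /L2ip /innerL2 /Cintegral => -[].
  under eq_Rintegral => x _.
    rewrite [Re _](_ : _ = a x * cos (angle k x) + b x * sin (angle k x)); last first.
      by rewrite complex_ReM complex_Re_conj complex_Im_conj mulrN opprK.
    over.
  move=> re0.
  under eq_Rintegral => x _.
    rewrite [Im _](_ : _ = b x * cos (angle k x) - a x * sin (angle k x)); last first.
      by rewrite complex_ImM complex_Re_conj complex_Im_conj mulrN addrC.
    over.
  by move: re0; rewrite RintegralD// RintegralB.
(* The coefficient at [- k] gives the equations of [E] with opposite signs; together they isolate
   the four real integrals. *)
have EN k : J (fun x => a x * cos (angle k x)) - J (fun x => b x * sin (angle k x)) = 0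
    /\ J (fun x => b x * cos (angle k x)) + J (fun x => a x * sin (angle k x)) = 0.
  have IC f : J (fun x => f x * cos (angle (- k) x)) = J (fun x => f x * cos (angle k x)).
    by apply: eq_Rintegral => x _; rewrite angleN cosN.
  have IS f : lam.-integrable setT (EFin \o (fun x => f x * sin (angle k x))) ->
      J (fun x => f x * sin (angle (- k) x)) = - J (fun x => f x * sin (angle k x)).
    move=> ifs; rewrite /J -mulN1r -RintegralZl//.
    by apply: eq_Rintegral => x _; rewrite angleN sinN mulN1r mulrN.
  by have := E (- k); rewrite !IC !IS// opprK.
have toE (f : T -> R) : lam.-integrable setT (EFin \o f) -> J f = 0 ->
    (\int[lam]_x (f x)%:E = 0)%E.
  by move=> intf J0; rewrite -[LHS]fineK ?(integrable_fin_num _ intf)//; congr EFin.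
have a0 : ae_eq lam setT (EFin \o a) (cst 0%E).
  apply: ae_eq0_of_fourier => // k; apply: toE => //.
    have [] := E k; have [] := EN k; lra.
  have [] := E k; have [] := EN k; lra.
have b0 : ae_eq lam setT (EFin \o b) (cst 0%E).
  apply: ae_eq0_of_fourier => // k; apply: toE => //.
    have [] := E k; have [] := EN k; lra.
  have [] := E k; have [] := EN k; lra.
rewrite -[u]subr0; apply: ipnorm_ae_eq.
apply: filterS2 a0 b0 => x ax bx _; have := ax I; have := bx I.
rewrite /a /b /=; case: (u x) => ? ? /= [->] [->] //.
Qed.

End totality.

(** * Orthonormality of the exponentials *)

Section orthonormality.
Context {R : realType}.
Local Notation mR := (measurableTypeR R).

Lemma integrable_cos d (T : measurableType d) (P : probability T R) (f : T -> R) :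
  measurable_fun setT f -> P.-integrable setT (fun x => (cos (f x))%:E).
Proof.
move=> mf; apply: (@le_integrable _ _ _ _ _ _ _ (cst 1%:E)) => //.
- apply/measurable_EFinP; apply: measurableT_comp => //.
  exact: (continuous_measurable_fun (@continuous_cos R)).
- by move=> x _; rewrite /= lee_fin normr1 cos_max.
- exact: finite_measure_integrable_cst.
Qed.

Lemma sinD2pi_int (n : int) (x : R) : sin (x + 2 * pi * n%:~R) = sin x.
Proof.
have H (m : nat) y : sin (y + 2 * pi * m%:R) = sin y :> R.
  by rewrite [2 * pi]mulr_natl mulr_natr (periodicn (@sinD2pi R)).
case: n => m; first by rewrite -pmulrn H.
by rewrite NegzE mulrNz mulrN -pmulrn -(H m.+1 (x - _)) subrK.
Qed.

(** The phase [c] lets one statement serve both cosine and sine. *)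
Lemma integral_cos01 (n : int) c : n != 0 ->
  (\int[@lebesgue01 R]_x (cos (2 * pi * (n%:~R * x) + c))%:E = 0)%E.
Proof.
move=> n0; pose w : R := 2 * pi * n%:~R.
have w0 : w != 0 by rewrite /w !mulf_eq0 intr_eq0 (negbTE n0) pnatr_eq0/= gt_eqF ?pi_gt0.
pose f x := cos (w * x + c).
have cf : continuous f.
  move=> x; apply: continuous_comp; last exact: continuous_cos.
  by apply: cvgD; [apply: cvgM; [exact: cvg_cst|]|exact: cvg_cst].
have mf : measurable_fun setT f by exact: continuous_measurable_fun.
have -> : (fun x : mR => (cos (2 * pi * (n%:~R * x) + c))%:E) = EFin \o f.
  by apply/funext => x /=; rewrite mulrA.
pose I01 : set mR := [set` `[0%R, 1%R[].
have m01 : measurable I01 by exact: measurable_itv.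
(* [lebesgue01] does not charge the complement of [0, 1[ and is Lebesgue measure inside, where the
   fundamental theorem of calculus applies. *)
rewrite (@negligible_integral _ _ _ _ _ (~` I01))//; last first.
- by rewrite -[LHS]/(lebesgue_measure (~` I01 `&` I01)) setICl measure0.
- apply: integrable_cos; have mw : measurable_fun setT (fun x : mR => w * x + c).
    apply: measurable_funD; last exact: measurable_cst.
    by apply: measurable_funM; [exact: measurable_cst|exact: measurable_id].
  exact: mw.
- exact: measurableC.
rewrite setTD setCK (@eq_measure_integral _ _ _ _ lebesgue_measure); last first.
  by move=> A mA A01; rewrite /= /lebesgue01 /mrestr setIidl.
rewrite integral_itv_bndo_bndc; last by apply/measurable_EFinP; exact: measurable_funTS.
pose F x := w^-1 * sin (w * x + c).
have dF (x : R) : is_derive x (1 : R) F (f x).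
  have d1 := is_deriveD (is_deriveZ w (is_derive_id x (1 : R))) (is_derive_cst c x (1 : R)).
  have d2 := is_deriveZ w^-1 (is_derive1_comp (is_derive_sin _) d1).
  have e : f x = w^-1 * (cos (w * x + c) * (w * 1 + 0)).
    by rewrite addr0 mulr1 mulrC mulfK.
  by rewrite e; exact: d2.
have cF : continuous F.
  by move=> x; apply/differentiable_continuous/derivable1_diffP; case: (dF x).
rewrite (@continuous_FTC2 _ f F)//.
- by rewrite -EFinB /F mulr1 mulr0 add0r [w + c]addrC sinD2pi_int subrr.
- exact: continuous_subspaceT.
- split.
  + by move=> x _; case: (dF x).
  + by apply: cvg_at_right_filter; exact: cF.
  + by apply: cvg_at_left_filter; exact: cF.
- by move=> x _; rewrite derive1E; apply: derive_val.
Qed.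

Lemma measurable_angle d (k : 'rV[int]_d) :
  measurable_fun setT (@angle R d k).
Proof.
apply: measurable_funM => //; apply: measurable_sum => i.
by apply: measurable_funM => //; exact: measurable_tnth.
Qed.

Lemma angle_cons d (k : 'rV[int]_d.+1) (x : mR) (t : d.-tuple mR) :
  angle k (cons_point (x, t)) =
  2 * pi * ((k 0 0)%:~R * x) + angle (\row_j k 0 (lift ord0 j)) t.
Proof.
rewrite /angle big_ord_recl mulrDr /=; congr (_ + _ * _).
by apply: eq_bigr => i _; rewrite mxE tnthS.
Qed.

Lemma integral_cos_angle d (k : 'rV[int]_d) c : k != 0 ->
  (\int[lebesgueT d]_x (cos (angle k x + c))%:E = 0 :> \bar R)%E.
Proof.
elim: d k c => [k c|d IH k c k0]; first by rewrite [k]thinmx0 eqxx.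
have mc : measurable_fun setT (fun x : d.+1.-tuple mR => angle k x + c).
  by apply: measurable_funD => //; exact: measurable_angle.
have icos := integrable_cos (lebesgue01 \x lebesgueT d)%E
  (measurableT_comp mc (@measurable_cons_point R d)).
rewrite /= integral_distribution//; last first.
  apply/measurable_EFinP; apply: measurableT_comp mc.
  exact: (continuous_measurable_fun (@continuous_cos R)).
(* The inner integral is taken over variables with a nonzero frequency: the first coordinate if all
   others have frequency 0, else the others, the first one then going into the phase of the
   induction hypothesis. *)
have [k'0|k'0] := eqVneq (\row_j k 0 (lift ord0 j)) 0.
  rewrite -integral21_prod_meas1//.
  rewrite /fubini_G integral0_eq// => t _.
  under eq_integral => x _ do
    rewrite /= angle_cons k'0 angle0 addr0.
  apply: integral_cos01; apply: contraNneq k0 => k00.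
  apply/eqP/rowP => j; rewrite mxE; case: (unliftP ord0 j) => [i|] ->//.
  by move/rowP: k'0 => /(_ i); rewrite !mxE.
rewrite -integral12_prod_meas1//.
rewrite /fubini_F integral0_eq// => x _.
under eq_integral => t _ do
  rewrite /= angle_cons -addrA addrC -addrA.
by rewrite IH.
Qed.

Lemma expkT_orth d k l : L2ip (@expkT R d k) (expkT l) = (k == l)%:R.
Proof.
rewrite /L2ip /innerL2.
under [X in Cintegral X]eq_fun => x do rewrite -expkN -expkD.
have [->|kl] := eqVneq k l.
  rewrite subrr /Cintegral.
  under eq_Rintegral do rewrite expk0.
  under [X in Complex _ X]eq_Rintegral do rewrite expk0.
  rewrite !Rintegral_cst//= mul0r mul1r.
  suff -> : fine (lebesgueT d [set: d.-tuple mR]) = 1 by [].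
  by rewrite probability_setT.
have kl0 : k - l != 0 by rewrite subr_eq0.
rewrite /Cintegral /Rintegral; congr Complex.
  apply: (congr1 fine (etrans _ (integral_cos_angle 0 kl0))).
  by apply: eq_integral => x _; rewrite addr0.
(* A sine is a cosine delayed by [pi / 2]. *)
apply: (congr1 fine (etrans _ (integral_cos_angle (- (pi / 2)) kl0))).
by apply: eq_integral => x _; rewrite cosBpihalf.
Qed.

End orthonormality.

(** * Outer functions *)

Section L2_operations.
Context {R : realType} {d : nat}.
Local Notation T := (d.-tuple (measurableTypeR R)).
Local Notation Zd := 'rV[int]_d.
Local Notation L2T := (@L2T R d).
Local Notation ip := (@L2ip R d).
Local Notation ipnorm := (ipnorm ip).
Local Notation ipP := (@L2ip_semi_inner R d).

Lemma L2T_eq (f g : L2T) : (forall x, f x = g x) -> f = g.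
Proof. by move=> fg; apply/val_inj/funext. Qed.

Lemma L2T_sumE I (r : seq I) (F : I -> L2T) x :
  (\sum_(i <- r) F i : L2T) x = \sum_(i <- r) F i x.
Proof.
elim: r => [|i r IH]; first by rewrite !big_nil.
by rewrite !big_cons -IH.
Qed.

Lemma L2_conjT (f : L2T) : L2 (fun x => (f x)^*).
Proof. exact: L2_conj (L2T_L2 f). Qed.

Definition conjT (f : L2T) : L2T := toL2 (L2_conjT f).

Lemma L2_modulate k (f : L2T) : L2 (fun x => expk k x * f x).
Proof.
apply: (L2M_bounded (Cmeasurable_expk k) (M := 1)) (L2T_L2 f) => x.
by rewrite cabs_expk.
Qed.

Definition modulate k (f : L2T) : L2T := toL2 (L2_modulate k f).

Lemma modulate_lin k a f g :
  modulate k (a *: f + g) = a *: modulate k f + modulate k g.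
Proof.
apply: L2T_eq => x /=; rewrite -[LHS]/(expk k x * (a * f x + g x)).
by rewrite -[RHS]/(a * (expk k x * f x) + expk k x * g x); ring.
Qed.

Lemma modulateB k f g : modulate k (f - g) = modulate k f - modulate k g.
Proof. by rewrite addrC -scaleN1r modulate_lin scaleN1r addrC. Qed.

Lemma modulate_expk k l : modulate k (expkT l) = expkT (k + l).
Proof. by apply: L2T_eq => x; rewrite /= expkD. Qed.

Lemma modulateD k l f : modulate k (modulate l f) = modulate (k + l) f.
Proof. by apply: L2T_eq => x; rewrite /= expkD mulrA. Qed.

Lemma ip_modulate k f g : ip (modulate k f) (modulate k g) = ip f g.
Proof.
rewrite /L2ip /innerL2; congr Cintegral; apply/funext => x /=.
rewrite rmorphM mulrACA mul_conj cabs_expk expr1n /=.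
by rewrite -[(real_complex _ _)]/(1 : R[i]) mul1r.
Qed.

Lemma ip_modulate_expk k l f : ip (modulate k f) (expkT l) = ip f (expkT (l - k)).
Proof. by rewrite -(ip_modulate k f) modulate_expk addrC subrK. Qed.

Lemma ipnorm_modulate k f : ipnorm (modulate k f) = ipnorm f.
Proof. by rewrite !ipnormE ip_modulate. Qed.

Lemma conjT_lin a f g : conjT (a *: f + g) = a^* *: conjT f + conjT g.
Proof.
apply: L2T_eq => x /=; rewrite -[LHS]/((a * f x + g x)^*).
by rewrite rmorphD rmorphM.
Qed.

Lemma conjTB f g : conjT (f - g) = conjT f - conjT g.
Proof. by rewrite addrC -scaleN1r conjT_lin rmorphN1 scaleN1r addrC. Qed.

Lemma conjT_expk k : conjT (expkT k) = expkT (- k).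
Proof. by apply: L2T_eq => x; rewrite /= expkN. Qed.

Lemma conjT_modulate k f : conjT (modulate k f) = modulate (- k) (conjT f).
Proof. by apply: L2T_eq => x /=; rewrite rmorphM expkN. Qed.

Lemma ip_conjT f g : ip (conjT f) (conjT g) = (ip f g)^*.
Proof.
rewrite /L2ip /innerL2 -Cintegral_conj; last exact: L2_cintegrable (L2T_L2 f) (L2T_L2 g).
by congr Cintegral; apply/funext => x /=; rewrite rmorphM.
Qed.

Lemma ip_conjT_expk f k : ip (conjT f) (expkT k) = (ip f (expkT (- k)))^*.
Proof. by rewrite -ip_conjT conjT_expk opprK. Qed.

Lemma ipnorm_conjT f : ipnorm (conjT f) = ipnorm f.
Proof. by rewrite !ipnormE ip_conjT complex_Re_conj. Qed.

Lemma closed_submod_modulate k M : closed_submod ip M ->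
  closed_submod ip [set f | M (modulate k f)].
Proof.
move=> [M0 MZD Mcl]; split => /= [|a u v Mu Mv|v H].
- have -> : modulate k 0 = 0.
    by rewrite -[X in modulate k X](subrr 0) modulateB subrr.
  exact: M0.
- by rewrite modulate_lin; exact: MZD.
- apply: Mcl => eps /H[w Mw wv]; exists (modulate k w) => //.
  by rewrite -modulateB ipnorm_modulate.
Qed.

Lemma closed_submod_conjT M : closed_submod ip M ->
  closed_submod ip [set f | M (conjT f)].
Proof.
move=> [M0 MZD Mcl]; split => /= [|a u v Mu Mv|v H].
- have -> : conjT 0 = 0 by rewrite -[X in conjT X](subrr 0) conjTB subrr.
  exact: M0.
- by rewrite conjT_lin; exact: MZD.
- apply: Mcl => eps /H[w Mw wv]; exists (conjT w) => //.
  by rewrite -conjTB ipnorm_conjT.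
Qed.

Lemma closed_submod_sum M I (r : seq I) (P : pred I) (c : I -> R[i]) (F : I -> L2T) :
  closed_submod ip M -> (forall i, P i -> M (F i)) ->
  M (\sum_(i <- r | P i) c i *: F i).
Proof.
move=> [M0 MZD _] MF; elim/big_rec: _ => [//|i x Pi Mx].
by apply: MZD => //; exact: MF.
Qed.

End L2_operations.

(** * Half-lattices and functions with spectrum in [S0] *)

Section half_lattice.
Context {R : realType} {d : nat}.
Local Notation T := (d.-tuple (measurableTypeR R)).
Local Notation Zd := 'rV[int]_d.
Local Notation L2T := (@L2T R d).
Local Notation ip := (@L2ip R d).
Local Notation ipnorm := (ipnorm ip).
Local Notation ipP := (@L2ip_semi_inner R d).

Variable S : set Zd.
Hypothesis S_cover : S `|` oppset S = ~` [set 0].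
Hypothesis S_disj : S `&` oppset S = set0.
Hypothesis S_add : forall k l, S k -> S l -> S (k + l).

Lemma oppsetE (A : set Zd) k : oppset A k <-> A (- k).
Proof.
split=> [[l Al <-]|Ak]; first by rewrite opprK.
by exists (- k); rewrite ?opprK.
Qed.

Definition S0 := S `|` [set 0].

Lemma S_trichotomy k : [\/ S k, k = 0 | S (- k)].
Proof.
have [->|k0] := eqVneq k 0; first by constructor 2.
have : (~` [set 0]) k by move=> /= kE; rewrite kE eqxx in k0.
by rewrite -S_cover => -[Sk|/oppsetE Sk]; [constructor 1|constructor 3].
Qed.

Lemma S_asym k : S k -> ~ S (- k).
Proof.
move=> Sk SNk; have : (S `&` oppset S) k by split => //; exact/oppsetE.
by rewrite S_disj.
Qed.

Lemma S_neq0 k : S k -> k <> 0.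
Proof. by move=> Sk k0; have := S_asym Sk; rewrite k0 oppr0 -k0. Qed.

Lemma notS0 k : ~ S0 k <-> S (- k).
Proof.
split=> [nk|SNk [Sk|k0]].
- by have [Sk|k0|//] := S_trichotomy k; case: nk; [left|right].
- exact: S_asym Sk SNk.
- by apply: (S_neq0 SNk); rewrite k0 oppr0.
Qed.

Lemma S0D k l : S0 k -> S0 l -> S0 (k + l).
Proof.
move=> [Sk|->] [Sl|->]; rewrite ?addr0 ?add0r; try by left.
- by left; exact: S_add.
- by right.
Qed.

Lemma SDS0 k l : S k -> S0 l -> S (k + l).
Proof. by move=> Sk [Sl|->]; rewrite ?addr0//; exact: S_add. Qed.

(** Membership of [k - l] in [S] is a strict total order, so a nonempty list has a largest
    element. *)
Lemma S_max (s : seq Zd) : s != [::] ->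
  exists2 k0, k0 \in s & forall k, k \in s -> k != k0 -> S (k0 - k).
Proof.
elim: s => // k [_ _|l s /(_ isT)[k0 k0s Hk0] _].
  by exists k => [|l]; rewrite !inE// => ->.
have [kk0|E|k0k] := S_trichotomy (k0 - k).
- exists k0; first by rewrite inE k0s orbT.
  by move=> j; rewrite inE => /orP[/eqP ->//|]; exact: Hk0.
- exists k0; first by rewrite inE k0s orbT.
  move=> j; rewrite inE => /orP[/eqP ->|]; last exact: Hk0.
  by rewrite eq_sym -subr_eq0 E eqxx.
- rewrite opprB in k0k; exists k; first by rewrite inE eqxx.
  move=> j; rewrite inE => /orP[->//|js _].
  have [->//|jk0] := eqVneq j k0.
  have -> : k - j = (k - k0) + (k0 - j) by rewrite addrA subrK.
  by apply: S_add => //; exact: Hk0.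
Qed.

Section analytic.
Variable Phi : L2T.
Hypothesis Phi_supp : forall k, ~ S0 k -> ip Phi (expkT k) = 0.

Lemma ip_modulate_supp j k : S0 j -> ~ S0 k -> ip (modulate j Phi) (expkT k) = 0.
Proof.
move=> Sj nSk; rewrite ip_modulate_expk Phi_supp// => Skj; apply: nSk.
by have := S0D Sj Skj; rewrite addrC subrK.
Qed.

(** The a_k and b_k of the overview. The spectrum lies in [k - S0], with top frequency [k], where
    the coefficient is the conjugate of that of [Phi] at 0. *)
Definition co_modulate k := modulate k (conjT Phi).

Lemma ip_co_modulate k j : ip (co_modulate k) (expkT j) = (ip Phi (expkT (k - j)))^*.
Proof. by rewrite ip_modulate_expk ip_conjT_expk opprB. Qed.

Lemma co_modulate_supp l k : oppset S l -> S0 k ->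
  ip (co_modulate l) (expkT k) = 0.
Proof.
move=> /oppsetE Sl Sk; rewrite ip_co_modulate Phi_supp ?conjC0// => Slk.
have := S0D Slk Sk; rewrite subrK => H.
by have /notS0 := Sl; exact.
Qed.

Hypothesis Phi0 : ip Phi (expkT 0) != 0.

(* The coefficient of the sum at the largest frequency that occurs comes from a
   single term. *)
Lemma co_modulate_free (s : seq Zd) c : uniq s ->
  ipnorm (\sum_(k <- s) c k *: co_modulate k) = 0 -> forall k, k \in s -> c k = 0.
Proof.
move=> us x0 k ks; apply/eqP/negP => /negP ck.
have [|k0] := @S_max [seq k <- s | c k != 0].
  have kf : k \in [seq k <- s | c k != 0] by rewrite mem_filter ck.
  by apply/negP => /eqP E; rewrite E in kf.
rewrite mem_filter => /andP[ck0 k0s] Hk0.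
have := ipnorm_null ipP (expkT k0) x0.
rewrite (ip_suml ipP) (bigD1_seq k0)//= [X in _ + X]big_seq_cond big1.
  rewrite addr0 (ipZl ipP) ip_co_modulate subrr => /eqP.
  by rewrite mulf_eq0 conjC_eq0 (negbTE ck0) (negbTE Phi0).
move=> j /andP[js jk0]; rewrite (ipZl ipP).
have [->|cj] := eqVneq (c j) 0; first by rewrite mul0r.
rewrite ip_co_modulate Phi_supp ?conjC0 ?mulr0//.
by apply/notS0; rewrite opprB; apply: Hk0; rewrite ?mem_filter ?cj.
Qed.

Hypothesis Phi_outer : Cmeasurable (fun x => (Phi x)^-1) /\
  forall eps, 0 < eps -> exists2 p, trig_span S0 p &
    (\int[lebesgueT d]_x (cabs ((Phi x)^-1 - p x) ^+ 2 * cabs (Phi x) ^+ 2)%:E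
     < eps%:E)%E.

(* The closure contains [chi = phi * phi^-1], the indicator of [phi != 0].  Its
   spectrum lies in [S0] and, [chi] being real, is symmetric, so that [chi] is
   constant; the constant is 1 because [phi] is not 0. *)
Lemma expk0_closure M : closed_submod ip M ->
  (forall k, S0 k -> M (modulate k Phi)) -> M (expkT 0).
Proof.
have [mV Hp] := Phi_outer.
(* Since [0^-1 = 0], this is only an indicator; that it is 1 almost everywhere comes out at the
   end. *)
pose chi x := Phi x * (Phi x)^-1.
have chiE x : chi x = (Phi x != 0)%:R.
  by rewrite /chi; have [->|p0] := eqVneq (Phi x) 0; rewrite ?mul0r ?divff.
have chi2 : L2 chi.
  apply: (L2_dom (k := fun _ : T => 1)) => [| |x].
  - by apply: CmeasurableM => //; case: (L2T_L2 Phi).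
  - exact: finite_measure_integrable_cst.
  - rewrite chiE; case: (Phi x != 0).
      by rewrite -[_%:R]/((1 : R)%:C) cabs_real normr1 expr1n.
    by rewrite -[_%:R]/((0 : R)%:C) cabs_real normr0 expr0n.
pose X := toL2 chi2.
(* Moving the weight inside the square turns [Phi^-1 - p] into [chi - p * Phi]. [N] is arbitrary
   because this serves twice: to locate the spectrum of [X], and for [M] itself. *)
have XM N : closed_submod ip N -> (forall k, S0 k -> N (modulate k Phi)) -> N X.
  move=> Nc NPhi; have [_ _ Ncl] := Nc; apply: Ncl => eps eps0.
  have [_ [s [c [sS ->]]] Hs] := Hp _ (exprn_gt0 2 eps0).
  exists (\sum_(k <- s) c k *: modulate k Phi).
    by rewrite big_seq; apply: closed_submod_sum => // k ks; apply/NPhi/sS.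
  rewrite -(@ltr_pXn2r _ 2)// ?nnegrE ?ipnorm_ge0 ?(ltW eps0)// -lte_fin ipnorm_sqrE.
  apply: le_lt_trans Hs; rewrite le_eqVlt; apply/orP; left; apply/eqP.
  apply: eq_integral => x _; congr EFin; rewrite -exprMn -cabsM.
  congr (cabs _ ^+ 2).
  rewrite -[L2val _ x]/(chi x - (\sum_(k <- s) c k *: modulate k Phi : L2T) x).
  rewrite L2T_sumE mulrBl /chi mulrC; congr (_ - _).
  rewrite mulr_suml; apply: eq_bigr => k _.
  by rewrite -[LHS]/(c k * (expk k x * Phi x)) mulrA.
have XC : conjT X = X.
  by apply: L2T_eq => x; rewrite /= chiE; case: (Phi x != 0); rewrite ?conjC1 ?conjC0.
have X0 k : ~ S0 k -> ip X (expkT k) = 0.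
  move=> nk; have : [set v | ip v (expkT k) = 0] X.
    apply: XM; first exact: ortho_closed_submod ipP (expkT k).
    by move=> j Sj /=; exact: ip_modulate_supp.
  by [].
have X0' k : k != 0 -> ip X (expkT k) = 0.
  move=> k0; have [Sk|k0'|SNk] := S_trichotomy k; last by apply/X0/notS0.
    rewrite -XC ip_conjT_expk X0 ?conjC0//; apply/notS0; by rewrite opprK.
  by rewrite k0' eqxx in k0.
set c := ip X (expkT 0) in X0 X0'.
have Xc : ipnorm (X - c *: expkT 0) = 0.
  apply: expkT_total => k; rewrite (ipBl ipP) (ipZl ipP) expkT_orth.
  have [<-|k0] := eqVneq; first by rewrite mulr1 subrr.
  by rewrite mulr0 X0' 1?eq_sym// subrr.
have Xae := ipnorm_ae0 Xc.
have c1 : c = 1.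
  apply/eqP/negP => /negP c1.
  (* [chi] is 1 wherever [Phi] is nonzero; being almost everywhere [c], different from 1, it forces
     [Phi] to vanish almost everywhere. *)
  have P0 : ipnorm (Phi - 0) = 0.
    apply: ipnorm_ae_eq; apply: filterS Xae => x /(_ I) Xx _.
    have {Xx} : chi x - c * expk 0 x = 0 by [].
    rewrite expk0 mulr1 => /eqP; rewrite subr_eq0 chiE.
    by have [->//|_] := eqVneq (Phi x) 0; rewrite eq_sym (negbTE c1).
  by move: Phi0; rewrite -[Phi]subr0 (ipnorm_null ipP _ P0) eqxx.
move=> Mc MPhi; have [_ _ Mcl] := Mc; apply: Mcl => eps eps0.
exists X; first exact: XM.
by rewrite (ipnormB_sym ipP) -[expkT 0]scale1r -c1 Xc.
Qed.

(** The [f] for which e_j times the conjugate of [f] is in [M] form a closed submodule. It contains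
    e_k [Phi] for [k] in [S0], because [j - k] stays in -S; hence it contains 1, and [M] contains
    e_j. *)
Lemma outer_dense M : closed_submod ip M ->
  (forall k, oppset S k -> M (co_modulate k)) ->
  forall j, oppset S j -> M (expkT j).
Proof.
move=> Mc Mco j /oppsetE Sj.
have := expk0_closure (closed_submod_modulate (- j) (closed_submod_conjT Mc)).
rewrite /= modulate_expk conjT_expk addr0 opprK; apply => k Sk.
rewrite modulateD conjT_modulate; apply: Mco; apply/oppsetE.
by rewrite opprK; exact: SDS0.
Qed.

End analytic.
End half_lattice.

Section comb_closure.
Context {R : realType} {V : lmodType R[i]} (ip : V -> V -> R[i]).
Hypothesis ipP : semi_inner ip.
Local Notation ipnorm := (ipnorm ip).
Context {I : choiceType} (a : I -> V) (Sn : nat -> seq I).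
Hypothesis Sn_uniq : forall n, uniq (Sn n).
Hypothesis Sn_incr : forall n, [set` Sn n] `<=` [set` Sn n.+1].

Definition comb_closure : set V := [set v |
  forall del, 0 < del -> exists n c, ipnorm (v - comb Sn a n c) < del].

(** Combinations from two stages can be added because the spans increase: [comb_widen] brings both
    to the later stage. *)
Lemma closed_submod_comb_closure : closed_submod ip comb_closure.
Proof.
split => [del del0|t u v Mu Mv del del0|v H del del0].
- exists 0%N, (fun=> 0); rewrite /comb big1 ?subr0 ?ipnorm0// => i _.
  by rewrite scale0r.
- have d2 : 0 < del / 2 by rewrite divr_gt0.
  have t0 : 0 < cabs t + 1 by rewrite ltr_wpDl ?cabs_ge0.
  have [n [c nc]] := Mu (del / 2 / (cabs t + 1)) (divr_gt0 d2 t0).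
  have [n' [c' nc']] := Mv _ d2.
  have [c1 E1] := comb_widen Sn_uniq Sn_incr a c (leq_maxl n n').
  have [c2 E2] := comb_widen Sn_uniq Sn_incr a c' (leq_maxr n n').
  exists (maxn n n'), (fun k => t * c1 k + c2 k).
  have -> : comb Sn a (maxn n n') (fun k => t * c1 k + c2 k) =
      t *: comb Sn a n c + comb Sn a n' c'.
    rewrite E1 E2 /comb scaler_sumr -big_split; apply: eq_bigr => k _ /=.
    by rewrite scalerDl scalerA.
  rewrite opprD addrACA -scalerBr.
  apply: le_lt_trans (ipnormD ipP _ _) _; rewrite (ipnormZ ipP) [ltRHS]splitr.
  apply: ler_ltD nc'; apply: le_trans (ler_wpM2l (cabs_ge0 t) (ltW nc)) _.
  rewrite mulrA ler_pdivrMr// mulrC ler_wpM2l ?divr_ge0 ?(ltW del0)//.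
  by rewrite lerDl.
- have d2 : 0 < del / 2 by rewrite divr_gt0.
  have [w /(_ _ d2)[n [c nc]] vw] := H _ d2; exists n, c.
  apply: le_lt_trans (ipnormB_tri ipP _ w _) _.
  by rewrite [ltRHS]splitr ltrD.
Qed.

Lemma comb_closure_mem n k : k \in Sn n -> comb_closure (a k).
Proof.
move=> kn del del0; exists n, (fun l => (l == k)%:R).
rewrite /comb (bigD1_seq k)//= eqxx scale1r big1 ?addr0 ?subrr ?ipnorm0//.
by move=> l /negbTE ->; rewrite scale0r.
Qed.

End comb_closure.

(** * From epsilon to the lower bound on combinations *)

Section spans.
Context {R : realType} {d : nat}.
Local Notation T := (d.-tuple (measurableTypeR R)).
Local Notation Zd := 'rV[int]_d.
Local Notation L2T := (@L2T R d).
Local Notation ip := (@L2ip R d).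
Local Notation ipnorm := (ipnorm ip).
Local Notation ipP := (@L2ip_semi_inner R d).
Variable Sn : nat -> seq Zd.
Hypothesis Sn_uniq : forall n, uniq (Sn n).

(** The dictionary between the two descriptions: conjugation carries the span of the a_k to [Phi]
    times trigonometric polynomials with frequencies [- k]. *)
Lemma comb_co_modulateE (Phi : L2T) n c x :
  comb Sn (co_modulate Phi) n c x =
  ((Phi x) * \sum_(k <- Sn n) (c k)^* * expk (- k) x)^*.
Proof.
rewrite /comb L2T_sumE rmorphM rmorph_sum mulr_sumr; apply: eq_bigr => k _ /=.
rewrite rmorphM /= expkN !conjCK.
by rewrite -[LHS]/(c k * (expk k x * (Phi x)^*)); ring.
Qed.

Lemma comb_mul_span (Phi : L2T) n c :
  mul_span Phi (oppset [set` Sn n]) (conjT (comb Sn (co_modulate Phi) n c)).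
Proof.
exists (fun x => \sum_(k <- Sn n) (c k)^* * expk (- k) x); last first.
  by apply/funext => x; rewrite /= comb_co_modulateE conjCK.
exists [seq - k | k <- Sn n], (fun k => (c (- k))^*); split.
  by move=> k /= /mapP[l ln ->]; apply/oppsetE; rewrite /= opprK.
by apply/funext => x; rewrite big_map; under [RHS]eq_bigr do rewrite opprK.
Qed.

Lemma mul_span_comb (Psi : L2T) n y :
  mul_span Psi (oppset [set` Sn n]) y ->
  exists c, y = conjT (comb Sn (co_modulate Psi) n c).
Proof.
move=> [_ [s [c [sS ->]]] <-].
(* The list [s] may repeat a frequency, so its coefficients are collected. *)
exists (fun l => (\sum_(k <- s | k == - l) c k)^*).
apply/funext => x; rewrite /= comb_co_modulateE conjCK; congr (_ * _).
under [RHS]eq_bigr => l _ do rewrite conjCK mulr_suml.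
rewrite (exchange_big_dep xpredT)//= big_seq [RHS]big_seq.
apply: eq_bigr => k ks; have kn : - k \in Sn n.
  by have /oppsetE := sS k ks.
under [RHS]eq_bigl => l do rewrite -eqr_oppLR eq_sym.
rewrite big_mkcond (bigD1_seq (- k))//= eqxx big1 ?addr0 ?opprK//.
by move=> l /negbTE ->.
Qed.

(** After normalizing [u], epsilon is at most the supremum attached to this one unit vector, which
    the assumption on [B] bounds by [B / ipnorm u]. *)
Lemma epsilonL2_lower_bound (Phi Psi : L2T) n (eps : R) : 0 < eps ->
  (eps%:E <= epsilonL2 (mul_span Phi (oppset [set` Sn n]))
                       (mul_span Psi (oppset [set` Sn n])))%E ->
  forall c B, 0 <= B ->
  (forall c', cabs (ip (comb Sn (co_modulate Phi) n c) (comb Sn (co_modulate Psi) n c'))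
     <= B * ipnorm (comb Sn (co_modulate Psi) n c')) ->
  eps * ipnorm (comb Sn (co_modulate Phi) n c) <= B.
Proof.
move=> eps0 epsn c B B0 HB; set u := comb Sn _ n c in HB *.
have [u0|u0] := eqVneq (ipnorm u) 0; first by rewrite u0 mulr0.
have ugt0 : 0 < ipnorm u by rewrite lt_neqAle eq_sym u0 ipnorm_ge0.
pose t : R := (ipnorm u)^-1.
have t0 : 0 <= t by rewrite invr_ge0 ltW.
pose v := t%:C *: u.
have vE : v = comb Sn (co_modulate Phi) n (fun k => t%:C * c k).
  by rewrite /v /u /comb scaler_sumr; apply: eq_bigr => k _; rewrite scalerA.
have v1 : ipnorm v = 1 by rewrite (ipnormZ ipP) cabs_real ger0_norm// mulVf.
rewrite -ler_pdivlMr// -lee_fin; apply: le_trans epsn _.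
apply: ereal_inf_le; exists (ereal_sup [set (cabs (innerL2 (conjT v) y))%:E
    | y in [set y | mul_span Psi (oppset [set` Sn n]) y /\ normL2 y = 1]]).
  exists (conjT v : T -> R[i]) => //; split; last by rewrite normL2_ipnorm ipnorm_conjT.
  by rewrite vE; exact: comb_mul_span.
apply: ge_ereal_sup => _ [y [/mul_span_comb[c' ->]]] + <-.
rewrite normL2_ipnorm ipnorm_conjT => y1.
rewrite -[innerL2 _ _]/(ip _ _) ip_conjT cabs_conj lee_fin (ipZl ipP) cabsM.
rewrite cabs_real ger0_norm// mulrC ler_wpM2r// (le_trans (HB c'))//.
by rewrite y1 mulr1.
Qed.

Lemma limn_einf_gt0 (u : nat -> \bar R) : (0 < limn_einf u)%E ->
  exists2 eps : R, 0 < eps & exists N, forall n, (N <= n)%N -> (eps%:E <= u n)%E.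
Proof.
rewrite limn_einf_lim (cvg_lim _ (@cvg_einfs_sup _ u))// => /ereal_sup_gt[_ [N _ <-]].
move=> q0; have qu n : (N <= n)%N -> (einfs u N <= u n)%E.
  by move=> Nn; apply: ereal_inf_lbound; exists n.
case E : (einfs u N) q0 qu => [q| |] // q0 qu; first by exists q => //; exists N.
(* An infinite infimum offers no real number to read off; any positive constant will do. *)
by exists 1 => //; exists N => n /qu; apply: le_trans; rewrite leey.
Qed.

End spans.

(** * The limit of the ratio of determinants *)

Section gram_determinants.
Context {R : realType} {d : nat}.
Local Notation T := (d.-tuple (measurableTypeR R)).
Local Notation func := (T -> R[i]).
Local Notation Zd := 'rV[int]_d.
Local Notation L2T := (@L2T R d).
Local Notation ip := (@L2ip R d).
Local Notation ipnorm := (ipnorm ip).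
Local Notation ipP := (@L2ip_semi_inner R d).

(** [riesz_fischer] shows that the set from which [xget] picks is inhabited, so the default value is
    never taken. *)
Lemma projHL2P (S : set Zd) (u : L2T) : exists p : L2T,
  [/\ projHL2 S u = p, forall k, S0 S k -> ip p (expkT k) = ip u (expkT k) &
      forall k, ~ S0 S k -> ip p (expkT k) = 0].
Proof.
have [w [wS wnS _]] := riesz_fischer ipP (@L2_complete R d) (@expkT_orth R d) (S0 S) u.
have [p2 pS] : [set g | L2 g /\ forall k : Zd,
    ((S `|` [set 0]) k -> fourier g k = fourier u k) /\
    (~ (S `|` [set 0]) k -> fourier g k = 0)] (projHL2 S u).
  rewrite /projHL2; case: xgetP => [g -> //|H].
  case: (H (w : func)); split; first exact: L2T_L2.
  by move=> k; split; [exact: wS|exact: wnS].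
by exists (toL2 p2); split => // k kS; case: (pS k) => H1 H2; [exact: H1|exact: H2].
Qed.

Lemma L2_mul_conj (phi psi f : func) (w : T -> R) : L2 phi -> L2 psi ->
  (forall x, cabs (phi x) ^+ 2 <= w x) ->
  (forall x, w x = cabs (phi x) ^+ 2 + cabs (psi x) ^+ 2) ->
  weightedL2 w f -> L2 (fun x => f x * (phi x)^*).
Proof.
move=> [mphi _] [mpsi _] phiw wE [mf fw].
have mw : measurable_fun setT (fun x => cabs (f x) ^+ 2 * w x).
  apply: measurable_funM; first exact: measurable_cabs_sqr.
  have -> : w = fun x => cabs (phi x) ^+ 2 + cabs (psi x) ^+ 2 by exact/funext.
  by apply: measurable_funD; exact: measurable_cabs_sqr.
have w0 x : 0 <= w x by rewrite wE addr_ge0 ?sqr_ge0.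
apply: (L2_dom (k := fun x => cabs (f x) ^+ 2 * w x)).
- by apply: CmeasurableM => //; exact: Cmeasurable_conj.
- apply/integrableP; split; first exact/measurable_EFinP.
  rewrite (eq_integral (fun x => (cabs (f x) ^+ 2 * w x)%:E))// => x _.
  by rewrite /= ger0_norm// mulr_ge0// sqr_ge0.
- by move=> x; rewrite cabsM cabs_conj exprMn ler_wpM2l ?sqr_ge0.
Qed.

Lemma gramdetE (phi psi : func) n (F G : n.-tuple func) (u v : 'I_n -> L2T) :
  (forall i x, u i x = tnth F i x * (phi x)^*) ->
  (forall i x, v i x = tnth G i x * (psi x)^*) ->
  gramdet (fun x => psi x * (phi x)^*) F G = \det (\matrix_(i, j) ip (u i) (v j)).
Proof.
move=> uE vE; congr (\det _); apply/matrixP => i j; rewrite !mxE.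
congr Cintegral; apply/funext => x; rewrite uE vE rmorphM /= conjCK; ring.
Qed.

Lemma gramdet_cat (phi psi : func) m (F G : m.-tuple func) (u v : 'I_m -> L2T)
    (s : seq Zd) (a b : Zd -> L2T) :
  (forall i x, u i x = tnth F i x * (phi x)^*) ->
  (forall i x, v i x = tnth G i x * (psi x)^*) ->
  (forall k x, a k x = expk k x * (phi x)^*) ->
  (forall k x, b k x = expk k x * (psi x)^*) ->
  gramdet (fun x => psi x * (phi x)^*) (cat_tuple F (exps s)) (cat_tuple G (exps s)) =
  \det (block_mx (\matrix_(i, j) ip (u i) (v j))
    (\matrix_(i, j) ip (u i) (b (tnth (in_tuple s) j)))
    (\matrix_(i, j) ip (a (tnth (in_tuple s) i)) (v j))
    (\matrix_(i, j) ip (a (tnth (in_tuple s) i)) (b (tnth (in_tuple s) j)))).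
Proof.
move=> uE vE aE bE.
pose glue (x : 'I_m -> L2T) (y : Zd -> L2T) (i : 'I_(m + size s)) :=
  match fintype.split i with inl i => x i | inr k => y (tnth (in_tuple s) k) end.
have gl x y i : glue x y (lshift (size s) i) = x i.
  by rewrite /glue (unsplitK (inl i)).
have gr x y i : glue x y (rshift m i) = y (tnth (in_tuple s) i).
  by rewrite /glue (unsplitK (inr i)).
rewrite (gramdetE (u := glue u a) (v := glue v b)).
- congr (\det _); apply/matrixP => i j; rewrite mxE.
  case: (split_ordP i) => i' ->; case: (split_ordP j) => j' ->;
  by rewrite ?block_mxEul ?block_mxEur ?block_mxEdl ?block_mxEdr !mxE ?gl ?gr.
- move=> i x; case: (split_ordP i) => i' ->.
    by rewrite gl uE tnth_lshift.
  by rewrite gr aE tnth_rshift tnth_map.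
- move=> i x; case: (split_ordP i) => i' ->.
    by rewrite gl vE tnth_lshift.
  by rewrite gr bE tnth_rshift tnth_map.
Qed.

End gram_determinants.

Theorem theorem5p5 (R : realType) (d : nat) (hd : (1 <= d)%N)
  (S : set 'rV[int]_d)
  (S_cover : S `|` oppset S = ~` [set 0])
  (S_disj : S `&` oppset S = set0)
  (S_add : forall k l, S k -> S l -> S (k + l))
  (Sn : nat -> seq 'rV[int]_d)
  (Sn_uniq : forall n, uniq (Sn n))
  (Sn_incr : forall n, [set` Sn n] `<=` [set` Sn n.+1])
  (Sn_cup : \bigcup_n [set` Sn n] = oppset S)
  (phi psi : torus R d -> R[i])
  (hphi : spectral_factor S phi) (hpsi : spectral_factor S psi)
  (heps : (0 < limn_einf (fun n =>
     epsilonL2 (mul_span phi (oppset [set` Sn n]))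
               (mul_span psi (oppset [set` Sn n]))))%E)
  (m : nat) (F G : m.-tuple (torus R d -> R[i]))
  (hF : forall i, weightedL2 (fun x => cabs (phi x) ^+ 2 + cabs (psi x) ^+ 2)
                    (tnth F i))
  (hG : forall i, weightedL2 (fun x => cabs (phi x) ^+ 2 + cabs (psi x) ^+ 2)
                    (tnth G i)) :
  let mu := fun x => psi x * (phi x)^*%C in
  let F' := map_tuple (fun f => projHL2 S (fun x => f x * (phi x)^*%C)) F in
  let G' := map_tuple (fun g => projHL2 S (fun x => g x * (psi x)^*%C)) G in
  (\forall n \near \oo, gramdet mu (exps (Sn n)) (exps (Sn n)) != 0) /\
  (fun n => gramdet mu (cat_tuple F (exps (Sn n))) (cat_tuple G (exps (Sn n)))
            / gramdet mu (exps (Sn n)) (exps (Sn n)) : R[i]^o) @ \oo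
    --> (gramdet (cst 1) F' G' : R[i]^o).
Proof.
move=> mu F' G'.
have ipP := @L2ip_semi_inner R d.
have [[phi2 phiS] phi0 [[mphiV _] phiO]] := hphi.
have [[psi2 psiS] _ _] := hpsi.
pose Phi := toL2 phi2; pose Psi := toL2 psi2.
have supp (f : torus R d -> R[i]) (f2 : L2 f) :
    (forall k, fourier f k != 0 -> (S `|` [set 0]) k) ->
    forall k, ~ S0 S k -> L2ip (toL2 f2) (expkT k) = 0.
  by move=> fS k nk; apply/eqP; apply: contra_notT nk; exact: fS.
have PhiS := supp _ phi2 phiS; have PsiS := supp _ psi2 psiS.
have Phi0 : L2ip Phi (expkT 0) != 0 by rewrite gt_eqF.
pose a := co_modulate Phi; pose b := co_modulate Psi.
have SnS n k : k \in Sn n -> oppset S k.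
  by move=> kn; rewrite -Sn_cup; exists n.
have a_free n c : ipnorm (@L2ip R d) (comb Sn a n c) = 0 ->
    forall k, k \in Sn n -> c k = 0.
  exact: (co_modulate_free S_cover S_disj S_add PhiS Phi0 (Sn_uniq n)).
have [eps eps0 [N HN]] := limn_einf_gt0 heps.
have lower n : (N <= n)%N -> forall c B, 0 <= B ->
    (forall c', cabs (L2ip (comb Sn a n c) (comb Sn b n c')) <=
                B * ipnorm (@L2ip R d) (comb Sn b n c')) ->
    eps * ipnorm (@L2ip R d) (comb Sn a n c) <= B.
  by move=> Nn; apply: epsilonL2_lower_bound => //; exact: HN.
have denseA M : closed_submod (@L2ip R d) M -> (forall k, oppset S k -> M (a k)) ->
    forall j, oppset S j -> M (expkT j).
  by apply: (outer_dense S_cover S_disj S_add PhiS Phi0); split.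
have u2 i : L2 (fun x => tnth F i x * (phi x)^*).
  by apply: (L2_mul_conj phi2 psi2) (hF i) => // x; rewrite lerDl sqr_ge0.
have v2 i : L2 (fun x => tnth G i x * (psi x)^*).
  apply: (L2_mul_conj psi2 phi2) (hG i) => x; last by rewrite addrC.
  by rewrite lerDr sqr_ge0.
pose u i := toL2 (u2 i); pose v i := toL2 (v2 i).
have [p Hp] := choice (fun i => projHL2P S (u i)).
have [q Hq] := choice (fun i => projHL2P S (v i)).
have gE n : gramdet mu (exps (Sn n)) (exps (Sn n)) = \det (cross_gram (@L2ip R d) a b Sn n).
  by apply: (gramdetE (phi := phi) (psi := psi)
     (u := fun i => a (tnth (in_tuple (Sn n)) i))
     (v := fun i => b (tnth (in_tuple (Sn n)) i))) => i x; rewrite tnth_map.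
have gcE n : gramdet mu (cat_tuple F (exps (Sn n))) (cat_tuple G (exps (Sn n))) =
   \det (block_mx
     (\matrix_(i, j) L2ip (u i) (v j))
     (\matrix_(i, j) L2ip (u i) (b (tnth (in_tuple (Sn n)) j)))
     (\matrix_(i, j) L2ip (a (tnth (in_tuple (Sn n)) i)) (v j))
     (cross_gram (@L2ip R d) a b Sn n)).
  exact: (gramdet_cat (phi := phi) (psi := psi)).
have lE : gramdet (cst 1) F' G' = \det (\matrix_(i, j) L2ip (p i) (v j)).
  congr (\det _); apply/matrixP => i j; rewrite !mxE.
  have [pE pS pnS] := Hp i; have [qE qS qnS] := Hq j.
  (* [v j - q j] has its spectrum off [S0], and [p i] has its spectrum in [S0]. *)
  have -> : L2ip (p i) (v j) = L2ip (p i) (q j).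
    apply/eqP; rewrite -subr_eq0 -(ipBr ipP); apply/eqP.
    apply: (ip_disjoint_supp ipP (@L2_complete R d) (@expkT_orth R d)
      (@expkT_total R d) (A := ~` S0 S)) => // k; rewrite /setC /= notK => kS.
    by rewrite (ipBl ipP) qS// subrr.
  congr Cintegral; apply/funext => x; rewrite mulr1 !tnth_map.
  by rewrite -[projHL2 S (fun x => tnth F i x * _)]/(projHL2 S (u i))
    -[projHL2 S (fun x => tnth G j x * _)]/(projHL2 S (v j)) pE qE.
split.
  exists N => // n /= Nn; rewrite gE.
  exact: (cross_gram_det ipP Sn_uniq a_free eps0 lower Nn).
under eq_cvg do rewrite gcE gE.
rewrite lE.
apply: (cvg_gram_ratio ipP Sn_uniq Sn_incr a_free eps0 lower).
  (* [p i] has its spectrum in [S0], while that of [b k] lies in -S. *)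
  move=> i n k kn; have [_ _ pnS] := Hp i.
  apply: (ip_disjoint_supp ipP (@L2_complete R d) (@expkT_orth R d)
      (@expkT_total R d) (A := ~` S0 S)) => // l; rewrite /setC /= notK => lS.
  exact: (co_modulate_supp S_cover S_disj S_add PsiS (SnS _ _ kn) lS).
move=> i.
have [_ pS _] := Hp i.
(* [u i - p i] has its spectrum in -S, and the closure of the combinations contains every
   exponential with frequency there by [denseA]. *)
apply: (closed_submod_supp ipP (@L2_complete R d) (@expkT_orth R d)
  (@expkT_total R d) (A := oppset S) (M := comb_closure (@L2ip R d) a Sn)).
- exact: closed_submod_comb_closure.
- apply: denseA; first exact: closed_submod_comb_closure.
  move=> k; rewrite -Sn_cup => -[n _ kn].
  exact: (comb_closure_mem ipP a Sn_uniq kn).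
- move=> k nk; rewrite (ipBl ipP) pS ?subrr//.
  by apply: contrapT => /(notS0 S_cover S_disj) SNk; apply/nk/oppsetE.
Qed.
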